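(* Let $n\ge2$. For any bounded Lipschitz domain $\Omega\subset\mathbb{R}^n$ one has $C_B(\Omega)\ge n$. Moreover, $C_B(\Omega)>n$ whenever one of the following two facts occurs: (1) there exist $i\in\{1,\dots,n\}$ and $g\in\mathcal{K}_i(\Omega,\mathbb{R})\cap L^2(\Omega,\mathbb{R})$ such that the unique solution $w\in H^1_0(\Omega,\mathbb{R})$ of $$-\Delta w=g\ \text{ in }\Omega,\qquad w=0\ \text{ on }\partial\Omega,$$ satisfies $$\int_\Omega\left|\frac{\partial w}{\partial x_i}\right|^2dx<\frac1n\int_\Omega|\nabla w|^2\,dx;$$ (2) there exists $h\in\mathcal{C}(\mathbb{R},\mathbb{R})$ such that the unique solution $w\in H^1_0(\Omega,\mathbb{R})$ of $$-\Delta w=h\Big(\sum_{i=1}^n x_i\Big)\ \text{ in }\Omega,\qquad w=0\ \text{ on }\partial\Omega,$$ satisfies $$\sum_{1\le i<j\le n}\int_\Omega\partial_{x_i}w\,\partial_{x_j}w\,dx<0.$$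
   Context: $L^2_0(\Omega,\mathbb{R})$ is the space of zero-mean functions in $L^2(\Omega,\mathbb{R})$. The Bogovskii constant of $\Omega$ is $$C_B(\Omega)=\sup_{f\in L^2_0(\Omega,\mathbb{R}),\ \|f\|_{L^2(\Omega)}=1}\ \inf\Big\{\|\nabla v\|_{L^2(\Omega)}^2;\ v\in H^1_0(\Omega,\mathbb{R}^n),\ \nabla\cdot v=f\text{ in }\Omega\Big\},$$ which is finite for bounded Lipschitz domains. $\mathcal{K}_i(\Omega,\mathbb{R})$ is the vector space of functions $g:\Omega\to\mathbb{R}$ that depend at most on the $i$-th variable, i.e. $g(x)=g(x_i)$ for all $x\in\Omega$ (constants included). Solutions of the Dirichlet problems are weak solutions. *)

(* Defs.v *)
From HB Require Import structures.
From mathcomp Require Import all_boot all_order all_algebra.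
From mathcomp Require Import all_classical all_reals all_analysis.

Set Implicit Arguments.
Unset Strict Implicit.
Unset Printing Implicit Defensive.

Import Order.TTheory GRing.Theory Num.Theory.
Import numFieldNormedType.Exports.

Local Open Scope classical_set_scope.
Local Open Scope ring_scope.

(* Points of R^n are row vectors. The norm on 'rV[R]_n is the sup norm, which
   induces the usual topology. *)

(* Borel sigma-algebra of R^n: generated by the coordinates, as the library
   does for n.-tuple. *)
Definition rV_display : measure_display := default_measure_display.

Section measurable_rV.
Variables (R : realType) (n : nat).

Let coors (i : 'I_n) (x : 'rV[R]_n) : R := x ord0 i.

Let rV_set0 : g_sigma_preimage coors set0.
Proof. exact: sigma_algebra0. Qed.

Let rV_setC A : g_sigma_preimage coors A -> g_sigma_preimage coors (~` A).
Proof. exact: sigma_algebraC. Qed.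

Let rV_bigcup (F : _^nat) : (forall i, g_sigma_preimage coors (F i)) ->
  g_sigma_preimage coors (\bigcup_i (F i)).
Proof. exact: sigma_algebra_bigcup. Qed.

HB.instance Definition _ := @isMeasurable.Build rV_display
  'rV[R]_n (g_sigma_preimage coors) rV_set0 rV_setC rV_bigcup.

End measurable_rV.

Section measurable_rV_lemmas.
Variable R : realType.

Lemma measurable_coord n (i : 'I_n) :
  measurable_fun [set: 'rV[R]_n] (fun x : 'rV[R]_n => x ord0 i).
Proof.
move=> _ Y mY; rewrite setTI; apply: sub_sigma_algebra => /=.
rewrite -bigcup_seq/=; exists i => /=; first by rewrite mem_index_enum.
by exists Y => //; rewrite setTI.
Qed.

Lemma measurable_fun_rV d (T : measurableType d) n (f : T -> 'rV[R]_n) :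
  (forall i, measurable_fun [set: T] (fun t => f t ord0 i)) ->
  measurable_fun [set: T] f.
Proof.
move=> mf _ A mA; rewrite setTI.
suff: @measurable _ 'rV[R]_n `<=` [set B | measurable (f @^-1` B)] by apply.
apply: smallest_sub.
  split=> /=; first by rewrite preimage_set0.
  - by move=> B mB; rewrite setTD preimage_setC; exact: measurableC.
  - by move=> F mF; rewrite preimage_bigcup; exact: bigcup_measurable.
move=> B; rewrite -bigcup_seq => -[i _ [C mC <-]] /=.
rewrite setTI; have := mf i measurableT C mC; rewrite setTI.
by [].
Qed.

End measurable_rV_lemmas.

Section lebesgue_measure_rV.
Variable R : realType.

Definition consrV n (p : R * 'rV[R]_n) : 'rV[R]_n.+1 :=
  \row_i oapp (p.2 ord0) p.1 (unlift ord0 i).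

Lemma consrV0 n (p : R * 'rV[R]_n) : consrV p ord0 ord0 = p.1.
Proof. by rewrite mxE unlift_none. Qed.

Lemma consrVS n (p : R * 'rV[R]_n) j : consrV p ord0 (lift ord0 j) = p.2 ord0 j.
Proof. by rewrite mxE liftK. Qed.

Lemma measurable_consrV n : measurable_fun [set: R * 'rV[R]_n] (@consrV n).
Proof.
apply: measurable_fun_rV => i; case: (unliftP ord0 i) => [j|] ->.
  rewrite (_ : (fun t => _) = (fun x : 'rV[R]_n => x ord0 j) \o snd).
    by apply: measurableT_comp => //; exact: measurable_coord.
  by apply/funext => p /=; rewrite consrVS.
rewrite (_ : (fun t => _) = fst) //.
by apply/funext => p /=; rewrite consrV0.
Qed.

Section step.
Variables (n : nat) (mu : {sigma_finite_measure set 'rV[R]_n -> \bar R}).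

Definition lebesgue_step : set 'rV[R]_n.+1 -> \bar R :=
  pushforward (lebesgue_measure \x mu)%E (@consrV n).

Let step : {measure set 'rV[R]_n.+1 -> \bar R} :=
  @measure_function_pushforward__canonical__measure_function_Measure
    _ _ _ _ _ (lebesgue_measure \x mu)%E _ (@measurable_consrV n).

HB.instance Definition _ := isMeasure.Build _ _ _ lebesgue_step
  (measure0 step) (@measure_ge0 _ _ _ step)
  (@measure_semi_sigma_additive _ _ _ step).

Let lebesgue_step_sigma_finite : sigma_finite [set: 'rV[R]_n.+1] lebesgue_step.
Proof.
have /sigma_finiteP[F [TF ndF Foo]] := sigma_finiteT (@lebesgue_measure R).
have /sigma_finiteP[G [TG ndG Goo]] := sigma_finiteT mu.
pose uncons (x : 'rV[R]_n.+1) := (x ord0 ord0, \row_j x ord0 (lift ord0 j)).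
have munc : measurable_fun [set: 'rV[R]_n.+1] uncons.
  apply/measurable_fun_pairP; split; first exact: measurable_coord.
  apply: measurable_fun_rV => i.
  rewrite (_ : (fun t => _) = (fun t : 'rV[R]_n.+1 => t ord0 (lift ord0 i))).
    exact: measurable_coord.
  by apply/funext => t /=; rewrite mxE.
have consK : cancel (@consrV n) uncons.
  move=> [x y]; congr pair; first exact: consrV0.
  by apply/rowP => j; rewrite mxE consrVS.
exists (fun k => uncons @^-1` (F k `*` G k)) => [|k].
  apply/seteqP; split=> // x _.
  have [i _ Fi] : (\bigcup_k F k) (uncons x).1 by rewrite -TF.
  have [j _ Gj] : (\bigcup_k G k) (uncons x).2 by rewrite -TG.
  exists (maxn i j) => //; split.
    by move: Fi; exact/subsetPset/ndF/leq_maxl.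
  by move: Gj; exact/subsetPset/ndG/leq_maxr.
have [mFk Fk] := Foo k; have [mGk Gk] := Goo k; split.
  by rewrite -[X in measurable X]setTI; apply: munc => //; exact: measurableX.
rewrite /lebesgue_step /pushforward -comp_preimage.
rewrite (_ : uncons \o _ = id); last exact/funext.
by rewrite preimage_id product_measure1E// lte_mul_pinfty// ge0_fin_numE.
Qed.

HB.instance Definition _ :=
  Measure_isSigmaFinite.Build _ _ _ lebesgue_step
    lebesgue_step_sigma_finite.

End step.

Fixpoint lebesgue_rV n : {sigma_finite_measure set 'rV[R]_n -> \bar R} :=
  match n with
  | 0 => (\d_(0 : 'rV[R]_0) : set 'rV[R]_0 -> \bar R)
  | m.+1 => lebesgue_step (lebesgue_rV m)
  end.

Lemma lebesgue_rVE n (A : 'I_n -> set R) : (forall i, measurable (A i)) ->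
  lebesgue_rV n [set x | forall i, A i (x ord0 i)] =
  (\prod_(i < n) lebesgue_measure (A i))%E.
Proof.
elim: n A => [|n IH] A mA.
  rewrite big_ord0 /= diracE mem_set //=; by case.
rewrite big_ord_recl -IH//= /lebesgue_step /pushforward.
pose B : set 'rV[R]_n := [set x | forall i, A (lift ord0 i) (x ord0 i)].
have mB : measurable B.
  rewrite (_ : B = \bigcap_(i in [set: 'I_n])
      ((fun x : 'rV[R]_n => x ord0 i) @^-1` A (lift ord0 i))).
    apply: fin_bigcap_measurable => // i _.
    by rewrite -[X in measurable X]setTI; exact: measurable_coord.
  by apply/seteqP; split=> x Bx i => [_|]; apply: Bx.
rewrite (_ : _ @^-1` _ = A ord0 `*` B) ?product_measure1E//; first exact: mA.
apply/seteqP; split=> p /= Ap.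
  split; first by rewrite -consrV0.
  by move=> i; rewrite -consrVS.
case: Ap => A0 AS i; case: (unliftP ord0 i) => [j|] ->.
  by rewrite consrVS.
by rewrite consrV0.
Qed.

End lebesgue_measure_rV.

Section sobolev.
Variables (R : realType) (n : nat).
Implicit Types (Omega : set 'rV[R]_n) (f g phi w : 'rV[R]_n -> R).
Implicit Types Dw Dphi : 'rV[R]_n -> 'rV[R]_n.
Local Notation mu := (lebesgue_rV R n).

(* Functions on Omega are represented by functions on R^n whose values outside
   Omega are irrelevant; gradients are row vectors. *)

Definition L2 Omega f : Prop :=
  measurable_fun Omega f /\ (\int[mu]_(x in Omega) (f x ^+ 2)%:E < +oo)%E.

Definition partial (i : 'I_n) f : 'rV[R]_n -> R :=
  fun x => 'D_(delta_mx ord0 i) f x.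

(* C^infinity: the iterated partial derivatives along every list of directions
   exist and are continuous. *)
Definition smooth f : Prop := forall s : seq 'I_n,
  continuous (foldr partial f s) /\
  forall i x, derivable (foldr partial f s) x (delta_mx ord0 i).

Definition test_fun Omega phi : Prop :=
  let supp := closure [set x | phi x != 0] in
  [/\ smooth phi, compact supp & supp `<=` Omega].

Definition weak_gradient Omega w Dw : Prop :=
  forall phi i, test_fun Omega phi ->
    (\int[mu]_(x in Omega) (w x * partial i phi x)%:E =
     - \int[mu]_(x in Omega) (Dw x ord0 i * phi x)%:E)%E.

(* The weak gradient, unique up to null sets, is an argument of the predicate:
   H1 Omega w Dw means that w is in H^1(Omega) with weak gradient Dw. *)
Definition H1 Omega w Dw : Prop :=
  [/\ L2 Omega w, forall i, L2 Omega (fun x => Dw x ord0 i)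
    & weak_gradient Omega w Dw].

(* Closure of the test functions for the H^1 norm. *)
Definition H10 Omega w Dw : Prop :=
  H1 Omega w Dw /\
  exists phi : nat -> 'rV[R]_n -> R,
    (forall k, test_fun Omega (phi k)) /\
    (\int[mu]_(x in Omega) ((phi k x - w x) ^+ 2 +
        \sum_(i < n) (partial i (phi k) x - Dw x ord0 i) ^+ 2)%:E)%E
      @[k --> \oo] --> 0%E.

(* Vector fields: row i of Dv x is the gradient of the i-th component, so the
   divergence is the trace of Dv x. *)
Definition H10_vec Omega (v : 'rV[R]_n -> 'rV[R]_n) (Dv : 'rV[R]_n -> 'M[R]_n)
    : Prop :=
  forall i, H10 Omega (fun x => v x ord0 i) (fun x => row i (Dv x)).

Definition L20 Omega f : Prop :=
  L2 Omega f /\ (\int[mu]_(x in Omega) (f x)%:E = 0)%E.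

(* The infimum of the empty set is +oo. *)
Definition bogovskii Omega : \bar R :=
  ereal_sup [set ereal_inf
      [set (\int[mu]_(x in Omega)
              (\sum_(i < n) \sum_(j < n) Dv x i j ^+ 2)%:E)%E
        | Dv in [set Dv | exists v, H10_vec Omega v Dv /\
                  {ae mu, forall x, Omega x -> \tr (Dv x) = f x}]]
    | f in [set f | L20 Omega f /\
                    (\int[mu]_(x in Omega) (f x ^+ 2)%:E = 1)%E]].

(* w is the weak solution of - Delta w = g in Omega, w = 0 on the boundary. *)
Definition weak_solution Omega g w Dw : Prop :=
  H10 Omega w Dw /\
  forall phi Dphi, H10 Omega phi Dphi ->
    (\int[mu]_(x in Omega) (\sum_(i < n) Dw x ord0 i * Dphi x ord0 i)%:E =
     \int[mu]_(x in Omega) (g x * phi x)%:E)%E.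

Definition depends_only_on Omega (i : 'I_n) g : Prop :=
  exists gamma : R -> R, forall x, Omega x -> g x = gamma (x ord0 i).

(* Near each boundary point Omega is, in some orthonormal coordinates
   y = x *m Q, the strict epigraph of a Lipschitz function of the coordinates
   other than y_i. *)
Definition bounded_lipschitz_domain Omega : Prop :=
  [/\ open Omega, connected Omega, Omega !=set0, bounded_set Omega &
    forall x0, (closure Omega `\` Omega) x0 ->
      exists (r : R) (Q : 'M[R]_n) (i : 'I_n) (gamma : 'rV[R]_n.-1 -> R) (k : R),
        [/\ 0 < r, Q *m Q^T = 1%:M, k.-lipschitz gamma &
          forall x, ball x0 r x ->
            (Omega x <-> gamma (col' i (x *m Q)) < (x *m Q) ord0 i)]].

End sobolev.

(* Main.v *)
Require Import Defs.
From HB Require Import structures.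
From mathcomp Require Import all_boot all_order all_algebra.
From mathcomp Require Import all_classical all_reals all_analysis.
From mathcomp Require Import measurable_realfun.
From mathcomp Require Import ring lra.

Set Implicit Arguments.
Unset Strict Implicit.
Unset Printing Implicit Defensive.

Import Order.TTheory GRing.Theory Num.Theory.
Import numFieldNormedType.Exports.

Local Open Scope classical_set_scope.
Local Open Scope ring_scope.

(** Fix a vector [c] and let [rho(x) = sum_j c_j x_j]. If [H' = h], integrating
    by parts in each [x_j] and summing over [j] gives, for every field [v] with
    components in H^1_0,
<<
      int H(rho) div v = - int h(rho) <c, v>,
>>
    so the divergence of [v] alone determines every integral [int h(rho) <c, v>]
    ([divergence_ridge]). Let [w] be the weak solution of [- Delta w = g] where
    [g] is a function of [rho]. The field [w c] has divergence [<c, grad w>]; let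
    [v] have divergence [l <c, grad w>] for a constant [l]. Then
    [int g <c, v> = l |c|^2 int g w = l |c|^2 |grad w|^2], and by the weak
    equation, tested against the components of [v], the left-hand side is the
    inner product of [grad v] with the matrix field [c (x) grad w]. Expanding
    [|grad v - l c (x) grad w|^2 >= 0] yields
    [|grad v|^2 >= l^2 |c|^2 |grad w|^2]: the field [l w c] has the least
    gradient among those with its divergence. Normalizing the divergence gives
    the lower bound
<<
      C_B >= |c|^2 |grad w|^2 / |<c, grad w>|^2
>>
    ([bogovskii_ge_ridge_ratio]). For [c = e_i] the right-hand side exceeds [n]
    under condition (1). For [c = (1, ..., 1)] it is
    [n |grad w|^2 / (|grad w|^2 + 2 s)], with [s] the sum in condition (2), and
    it exceeds [n] when [s < 0].

    In case (2) the function [g = h(rho)] has a continuous profile [h]. In case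
    (1) [g] is only square integrable, and its profile may be non-integrable near
    the ends of the projection of the domain, so that a primitive of it can be
    unbounded. There the function [u = v_i - l w] satisfies [int h(x_i) u = 0]
    for all continuous [h]; this passes to indicators of Borel sets by a Dynkin
    argument, then to simple functions, then to [g] by dominated convergence
    ([null_measurable_fun], [depends_only_on_measurable]).

    The bound [C_B >= n] is the case [g = 1] in disguise. If [- Delta w = 1] then
    [g] depends only on [x_i] for every [i], and as the numbers [|d_i w|^2] add
    up to [|grad w|^2], some [i] makes the ratio at least [n]. The function [w]
    maximizes [(int phi)^2 / |grad phi|^2], and test functions [phi] that nearly
    maximize this quotient serve as well: if [div v = l d_i phi], then testing
    against [x_i] gives [int v_i = l int phi], whence
    [|grad v|^2 >= |grad v_i|^2 >= l^2 (int phi)^2 / S] where [S] is the supremum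
    of the quotient ([bogovskii_ge_mass]). This presupposes a test function with
    nonzero integral. If all these integrals vanish, then [int v_i = 0] for every
    admissible [v], hence [div v] is orthogonal to [x_i]; no [v] then has a
    positive multiple of [x_i - mean] as its divergence, and [C_B] is infinite
    ([bogovskii_ge_no_mass]).

    All integrations by parts come down to [integral_partial_eq0]: the integral
    over the whole space of a partial derivative of a compactly supported
    function is zero. *)

(** * Borel sets of row vectors *)

Section borel.
Variables (R : realType) (n : nat).
Implicit Types (A : set 'rV[R]_n) (x q : 'rV[R]_n).

Lemma rV_ballE x (e : R) : 0 < e ->
  ball x e = [set y | forall i, `|x ord0 i - y ord0 i| < e].
Proof.
move=> e0; apply/seteqP; split=> y /=; rewrite /ball/= /mx_ball.
  by move=> [_ xy] i; apply: xy.
by move=> xy; split=> // i j; rewrite (ord1 i); exact: xy.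
Qed.

Lemma measurable_rV_ball x (e : R) : 0 < e -> measurable (ball x e).
Proof.
move=> e0; rewrite (_ : ball x e = \bigcap_(i in [set: 'I_n])
    ((fun x : 'rV[R]_n => x ord0 i) @^-1` ball (x ord0 i) e)).
  apply: fin_bigcap_measurable => // i _.
  rewrite -[X in measurable X]setTI; apply: measurable_coord => //.
  exact: measurable_ball.
rewrite rV_ballE//; apply/seteqP; split=> y yx i => [_|]; exact: yx.
Qed.

(** A countable base of open boxes, each of them measurable because it is cut out
    by conditions on the coordinates. *)
Definition rat_ball (p : 'rV[rat]_n * nat) : set 'rV[R]_n :=
  ball (map_mx ratr p.1 : 'rV[R]_n) (p.2.+1%:R^-1 : R).

Lemma rat_ballE p : rat_ball p =
  [set y | forall i, `|ratr (p.1 ord0 i) - y ord0 i| < p.2.+1%:R^-1].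
Proof.
rewrite /rat_ball rV_ballE ?invr_gt0//.
by apply/seteqP; split => y yp i; have := yp i; rewrite mxE.
Qed.

Lemma measurable_rat_ball p : measurable (rat_ball p).
Proof. by apply: measurable_rV_ball; rewrite invr_gt0. Qed.

Lemma open_bigcup_rat_ball A : open A ->
  A = \bigcup_(p in [set p | rat_ball p `<=` A]) rat_ball p.
Proof.
move=> oA; apply/seteqP; split => x; last by move=> [p /= pA] /pA.
move=> Ax; have /nbhs_ballP[e /= e0] : nbhs x A by apply: open_nbhs_nbhs.
rewrite rV_ballE// => xeA.
have [k ke] : exists k : nat, k.+1%:R^-1 < e / 2.
  have e20 : 0 < e / 2 by rewrite divr_gt0.
  by have := ltr_add_invr e20 => -[k]; rewrite add0r; exists k.
have k0 : (0 : R) < k.+1%:R^-1 by rewrite invr_gt0.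
have /choice[q qx] i : exists q : rat, `|ratr q - x ord0 i| < k.+1%:R^-1.
  have [|q] := @rat_in_itvoo R (x ord0 i - k.+1%:R^-1) (x ord0 i + k.+1%:R^-1).
    by rewrite ltrD2l gt0_cp.
  by rewrite in_itv/= => qi; exists q; rewrite ltr_distl.
exists (\row_i q i, k); rewrite /= rat_ballE; last first.
  by move=> i; rewrite mxE.
move=> y /= qy; apply: xeA => i; have := qy i; rewrite mxE => qyi.
rewrite (le_lt_trans (ler_distD (ratr (q i)) _ _))//.
by rewrite (splitr e) ltrD// (lt_trans _ ke)// distrC.
Qed.

(** The indices of the rational balls form a countable type, so unions over any
    family of them stay measurable, also for sets living in another space. *)
Lemma bigcup_rat_ball_measurable d (T : measurableType d)
    (P : set ('rV[rat]_n * nat)) (F : 'rV[rat]_n * nat -> set T) :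
  (forall p, P p -> measurable (F p)) ->
  measurable (\bigcup_(p in P) F p).
Proof.
move=> mF; rewrite bigcup_mkcond; apply: countable_bigcupT_measurable.
  exact: countableP.
by move=> p; case: ifPn => // /set_mem; exact: mF.
Qed.

Lemma open_measurable_rV A : open A -> measurable A.
Proof.
move=> /open_bigcup_rat_ball ->; apply: bigcup_rat_ball_measurable => p _.
exact: measurable_rat_ball.
Qed.

Lemma continuous_measurable_rV (f : 'rV[R]_n -> R) :
  continuous f -> measurable_fun setT f.
Proof.
move=> cf; apply: (measurability _ (RGenOpens.measurableE R)).
move=> _ [_ [a [b ->] <-]]; apply: measurableI => //.
apply: open_measurable_rV; apply: open_comp; last exact: interval_open.
by move=> x _; exact: cf.
Qed.

Lemma ler_coord_norm x i : `|x ord0 i| <= `|x|.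
Proof.
rewrite -[leRHS]/(mx_norm x) mx_normrE; apply/bigmax_geP; right => /=.
by exists (ord0, i).
Qed.

Lemma bounded_set_coord A : bounded_set A -> exists2 M : R, 0 < M &
  forall x, A x -> forall i, `|x ord0 i| <= M.
Proof.
move=> [M [_ MA]]; exists (`|M| + 1); first by rewrite ltr_wpDl.
move=> x Ax i; have := MA (`|M| + 1).
rewrite (le_lt_trans (ler_norm _)) ?ltrDl// => /(_ isT x Ax) /=.
by apply: le_trans; exact: ler_coord_norm.
Qed.

(** A box in [R^n] is a product of intervals, so its measure is a finite product
    of lengths; this makes all bounded sets have finite measure. *)
Lemma lebesgue_box (M : R) :
  (lebesgue_rV R n [set x | forall i, (x ord0 i \in `[- M, M])%R] < +oo)%E.
Proof.
rewrite (@lebesgue_rVE _ _ (fun=> `[(- M)%R, M]%classic))//.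
suff /andP[] : (0 <= \prod_(i < n) (@lebesgue_measure R) `[(- M)%R, M] < +oo)%E by [].
elim/big_ind : _.
- by rewrite lee01 ltry.
- move=> x y /andP[x0 xoo] /andP[y0 yoo].
  by rewrite mule_ge0// lte_mul_pinfty// ge0_fin_numE.
- move=> i _; rewrite measure_ge0/=.
  by rewrite lebesgue_measure_itv/=; case: ifP => // _; rewrite -EFinD ltry.
Qed.

Lemma measurable_box (M : R) :
  measurable [set x : 'rV[R]_n | forall i, x ord0 i \in `[- M, M]].
Proof.
rewrite (_ : mkset _ = \bigcap_(i in [set: 'I_n])
    ((fun x : 'rV[R]_n => x ord0 i) @^-1` `[(-M)%R, M])).
  apply: fin_bigcap_measurable => // i _.
  by rewrite -[X in measurable X]setTI; apply: measurable_coord.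
by apply/seteqP; split=> y yx i => [_|]; apply: yx.
Qed.

Lemma bounded_lebesgue_fin A : measurable A -> bounded_set A ->
  (lebesgue_rV R n A < +oo)%E.
Proof.
move=> mA /bounded_set_coord[M M0 AM]; apply: le_lt_trans (lebesgue_box M).
apply: le_measure; rewrite ?inE//; first exact: measurable_box.
by move=> x Ax i; rewrite in_itv/= -ler_norml; exact: AM.
Qed.

End borel.

(** * Integration by parts on the whole space *)

Section divergence.
Variable R : realType.

Lemma consrV_ord0 n (t : R) (y : 'rV[R]_n) :
  consrV (t, y) = consrV (0, y) + t *: delta_mx ord0 ord0.
Proof.
apply/rowP => i; rewrite !mxE/=; case: (unliftP ord0 i) => [k|] ->.
  by rewrite /= mulr0 addr0.
by rewrite /= ?eqxx mulr1 add0r.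
Qed.

Lemma consrV_lift n (s t : R) (y : 'rV[R]_n) k :
  consrV (s, y + t *: delta_mx ord0 k) =
  consrV (s, y) + t *: delta_mx ord0 (lift ord0 k).
Proof.
apply/rowP => i; rewrite !mxE/=; case: (unliftP ord0 i) => [l|] ->.
  by rewrite /= !mxE/= (inj_eq (@lift_inj _ _)).
by rewrite /= ?eqxx mulr0 addr0.
Qed.

Lemma consrV_continuousr n (t : R) : continuous (fun y : 'rV[R]_n => consrV (t, y)).
Proof.
move=> y.
have F := nbhs_filter y; apply/(@cvg_ballP _ _ _ (@nbhs _ _ y) F) => e e0.
apply/nbhs_ballP; exists e => //= z; rewrite !rV_ballE//= => yz i.
rewrite !mxE; case: (unliftP ord0 i) => [l _|_] //=.
by rewrite subrr normr0.
Qed.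

Lemma consrV_continuousl n (y : 'rV[R]_n) : continuous (fun t : R => consrV (t, y)).
Proof.
move=> t; apply/cvg_ballP => e e0.
apply/nbhs_ballP; exists e => //= s; rewrite rV_ballE//= => ts i.
by rewrite !mxE; case: (unliftP ord0 i) => [l _|_] //=; rewrite subrr normr0.
Qed.

(** The one-dimensional case, by the fundamental theorem of calculus on an
    interval outside of which everything vanishes. *)
Lemma integral_derive_eq0 (M : R) (f d : R -> R) :
  continuous d -> (forall t : R, is_derive t 1 f (d t)) ->
  (forall t, M <= `|t| -> f t = 0) -> (forall t, M <= `|t| -> d t = 0) ->
  (\int[lebesgue_measure]_t (d t)%:E = 0)%E.
Proof.
move=> cd fd f0 d0.
(* [M] may be negative; [|M| + 1] bounds a nondegenerate interval in any case. *)
have M0 : - (`|M| + 1) < `|M| + 1.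
  by rewrite gtrN// ltr_wpDl.
have Mle t : `|M| + 1 <= `|t| -> M <= `|t|.
  by apply: le_trans; rewrite (le_trans (ler_norm _))// lerDl.
transitivity (\int[lebesgue_measure]_(t in `[(- (`|M| + 1))%R, (`|M| + 1)%R]) (d t)%:E)%E.
  rewrite [RHS]integral_mkcond; apply: eq_integral => t _.
  rewrite patchE; case: ifPn => // /negP; rewrite inE/= in_itv/= -ler_norml => tM.
  by rewrite d0// Mle// leNgt; apply/negP => /ltW.
have fc : continuous f.
  by move=> t; apply: differentiable_continuous; apply/derivable1_diffP; case: (fd t).
rewrite (@continuous_FTC2 _ _ f)//.
- by rewrite !f0 ?normrN ?Mle ?ler_norm// sube0.
- exact: continuous_subspaceT.
- split.
  + by move=> t _; case: (fd t).
  + exact/cvg_at_right_filter/fc.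
  + exact/cvg_at_left_filter/fc.
- by move=> t _; rewrite derive1E; apply: derive_val.
Qed.

Lemma compact_support_bounded n (M : R) (d : 'rV[R]_n -> R) :
  continuous d -> (forall (x : 'rV[R]_n) i, M <= `|x ord0 i| -> d x = 0) ->
  exists C, forall x, `|d x| <= C.
Proof.
move=> cd d0.
pose K := [set x : 'rV[R]_n | forall i, x ord0 i \in `[- M, M]].
have cK : compact K.
  apply: (@rV_compact _  _ (fun=> `[(- M)%R, M]%classic)).
  by move=> _; apply: segment_compact.
have : compact (d @` K).
  by apply: continuous_compact => //; exact: continuous_subspaceT.
move=> /compact_bounded[C [_ dC]]; exists (`|C| + 1) => x.
have [Kx|] := pselect (K x).
  by apply: (dC _ _ (d x)) => //; rewrite (le_lt_trans (ler_norm _))// ltrDl.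
move=> /existsNP[i]; rewrite in_itv/= -ler_norml => /negP; rewrite -ltNge => /ltW Mi.
by rewrite (d0 _ _ Mi) normr0 addr_ge0.
Qed.

Lemma compact_support_integrable n (M : R) (d : 'rV[R]_n -> R) :
  continuous d -> (forall (x : 'rV[R]_n) i, M <= `|x ord0 i| -> d x = 0) ->
  (lebesgue_rV R n).-integrable setT (EFin \o d).
Proof.
move=> cd d0; have [C dC] := compact_support_bounded cd d0.
have md := continuous_measurable_rV cd.
pose K := [set x : 'rV[R]_n | forall i, x ord0 i \in `[- M, M]].
have -> : EFin \o d = (EFin \o d) \_ K.
  apply/funext => x; rewrite patchE; case: ifPn => //; rewrite notin_setE.
  move=> /existsNP[i]; rewrite in_itv/= -ler_norml => /negP; rewrite -ltNge => /ltW Mi.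
  by rewrite (d0 _ _ Mi).
have mK : measurable K by exact: measurable_box.
apply: (proj1 (integrable_mkcond _ mK)).
apply: measurable_bounded_integrable.
- exact: mK.
- exact: lebesgue_box.
- exact: measurable_funTS.
- exists C; split; first exact: num_real.
  by move=> y Cy x _; rewrite /= (le_trans (dC _))// ltW.
Qed.

Lemma ge0_integral_consrV n (f : 'rV[R]_n.+1 -> \bar R) :
  measurable_fun setT f -> (forall x, 0 <= f x)%E ->
  (\int[lebesgue_rV R n.+1]_x f x =
   \int[(lebesgue_measure \x lebesgue_rV R n)%E]_p f (consrV p))%E.
Proof.
move=> mf f0.
pose P : {measure set _ -> \bar R} := (lebesgue_measure \x lebesgue_rV R n)%E.
have H phi m := @ge0_integral_pushforward _ _ _ _ R phi m P setT f
  measurableT mf (fun x _ => f0 x).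
exact: (H (@consrV R n) (@measurable_consrV R n)).
Qed.

Lemma integral_consrV n (f : 'rV[R]_n.+1 -> \bar R) :
  measurable_fun setT f ->
  (lebesgue_measure \x lebesgue_rV R n)%E.-integrable setT (f \o @consrV R n) ->
  (\int[lebesgue_rV R n.+1]_x f x =
   \int[(lebesgue_measure \x lebesgue_rV R n)%E]_p f (consrV p))%E.
Proof.
move=> mf fi.
pose P : {measure set _ -> \bar R} := (lebesgue_measure \x lebesgue_rV R n)%E.
have H phi m i := @integral_pushforward _ _ _ _ R phi m P setT f mf i
  measurableT.
exact: (H (@consrV R n) (@measurable_consrV R n) fi).
Qed.

(** Induction on the dimension through Fubini's theorem: the measure on [R^(n+1)]
    is the image of a product under [consrV]. For the first coordinate the inner
    integral is one-dimensional; for the others it falls under the induction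
    hypothesis. The derivative is taken along lines [s |-> x + s e_j], a form
    that is inherited by the slices. *)
Theorem integral_partial_eq0 n (j : 'I_n) (M : R) (psi d : 'rV[R]_n -> R) :
  continuous d ->
  (forall (x : 'rV[R]_n) (t : R),
    is_derive t 1 (fun s : R => psi (x + s *: delta_mx ord0 j))
                  (d (x + t *: delta_mx ord0 j))) ->
  (forall (x : 'rV[R]_n) i, M <= `|x ord0 i| -> psi x = 0) ->
  (forall (x : 'rV[R]_n) i, M <= `|x ord0 i| -> d x = 0) ->
  (\int[lebesgue_rV R n]_x (d x)%:E = 0)%E.
Proof.
elim: n => [|n IH] in j psi d *; first by case: j.
move=> cd psid psi0 d0.
have id := compact_support_integrable cd d0.
have md := continuous_measurable_rV cd.
have mdc : measurable_fun setT (d \o @consrV R n).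
  by apply: measurableT_comp => //; exact: measurable_consrV.
have idc : (lebesgue_measure \x lebesgue_rV R n)%E.-integrable setT
   (EFin \o (d \o @consrV R n)).
  apply/integrableP; split; first exact/measurable_EFinP.
  have /integrableP[_] := id; rewrite ge0_integral_consrV//.
  by do 2 apply: measurableT_comp => //.
transitivity (\int[(lebesgue_measure \x lebesgue_rV R n)%E]_p (d (consrV p))%:E)%E.
  by rewrite integral_consrV//; exact/measurable_EFinP.
case: (unliftP ord0 j) => [k|] jE; subst j.
  rewrite -integral12_prod_meas1//; apply: integral0_eq => t _.
  rewrite /fubini_F; apply: (IH k (fun y => psi (consrV (t, y)))).
  - move=> y; apply: continuous_comp; [exact: consrV_continuousr|exact: cd].
  - move=> y s; rewrite consrV_lift; under eq_fun do rewrite consrV_lift.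
    exact: psid.
  - by move=> y i My; apply: (psi0 _ (lift ord0 i)); rewrite consrVS.
  - by move=> y i My; apply: (d0 _ (lift ord0 i)); rewrite consrVS.
rewrite -integral21_prod_meas1//; apply: integral0_eq => y _.
rewrite /fubini_G; apply: (@integral_derive_eq0 M (fun t => psi (consrV (t, y)))).
- move=> t; apply: continuous_comp; [exact: consrV_continuousl|exact: cd].
- move=> t; rewrite consrV_ord0; under eq_fun do rewrite consrV_ord0.
  exact: psid.
- by move=> t Mt; apply: (psi0 _ ord0); rewrite consrV0.
- by move=> t Mt; apply: (d0 _ ord0); rewrite consrV0.
Qed.

End divergence.

(** * Square-integrable functions on a measurable set *)

Section L2_theory.
Variables (R : realType) (n : nat) (Omega : set 'rV[R]_n).
Hypothesis mO : measurable Omega.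
Local Notation mu := (lebesgue_rV R n).
Local Notation I f := (Rintegral mu Omega f).
Local Notation intble f := (mu.-integrable Omega (EFin \o f)).
Implicit Types f g h : 'rV[R]_n -> R.

Lemma L2_measurable f : L2 Omega f -> measurable_fun Omega f.
Proof. by case. Qed.

Lemma L2_integrable_sqr f : L2 Omega f -> intble (fun x => f x ^+ 2).
Proof.
move=> [mf foo]; apply/integrableP; split.
  by apply/measurable_EFinP; apply: measurable_funX.
by under eq_integral => x _ do rewrite /= ger0_norm ?sqr_ge0//.
Qed.

Lemma integrable_EFinD f g : intble f -> intble g -> intble (fun x => f x + g x).
Proof. exact: integrableD. Qed.

Lemma integrable_EFinZ (k : R) f : intble f -> intble (fun x => k * f x).
Proof. exact: integrableZl. Qed.

Lemma integrable_EFinB f g : intble f -> intble g -> intble (fun x => f x - g x).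
Proof. exact: integrableB. Qed.

(** [|f g| <= f^2 + g^2]. *)
Lemma L2_integrableM f g : L2 Omega f -> L2 Omega g ->
  intble (fun x => f x * g x).
Proof.
move=> Lf Lg.
apply: (@le_integrable _ _ _ mu _ mO _ (EFin \o (fun x => f x ^+ 2 + g x ^+ 2))).
- by apply/measurable_EFinP; apply: measurable_funM; exact: L2_measurable.
- move=> x _ /=; rewrite lee_fin normrM [leRHS]ger0_norm ?addr_ge0 ?sqr_ge0//.
  rewrite -(real_normK (num_real (f x))) -(real_normK (num_real (g x))).
  have := sqr_ge0 (`|f x| - `|g x|); have := sqr_ge0 (`|f x| + `|g x|).
  by nra.
- by apply: integrable_EFinD; exact: L2_integrable_sqr.
Qed.

Lemma L2_sqrI f : measurable_fun Omega f -> intble (fun x => f x ^+ 2) -> L2 Omega f.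
Proof.
move=> mf fi; split => //; exact: integrable_lty.
Qed.

Lemma L2D f g : L2 Omega f -> L2 Omega g -> L2 Omega (fun x => f x + g x).
Proof.
move=> Lf Lg; apply: L2_sqrI.
  by apply: measurable_funD; exact: L2_measurable.
rewrite (_ : (fun x => _) = (fun x => f x ^+ 2 + (2 * (f x * g x) + g x ^+ 2))).
  apply: integrable_EFinD; first exact: L2_integrable_sqr.
  apply: integrable_EFinD; last exact: L2_integrable_sqr.
  by apply: integrable_EFinZ; exact: L2_integrableM.
by apply/funext => x; ring.
Qed.

Lemma L2Z (k : R) f : L2 Omega f -> L2 Omega (fun x => k * f x).
Proof.
move=> Lf; apply: L2_sqrI.
  by apply: measurable_funM => //; exact: L2_measurable.
rewrite (_ : (fun x => _) = (fun x => k ^+ 2 * f x ^+ 2)).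
  by apply: integrable_EFinZ; exact: L2_integrable_sqr.
by apply/funext => x; rewrite exprMn.
Qed.

Lemma L2B f g : L2 Omega f -> L2 Omega g -> L2 Omega (fun x => f x - g x).
Proof.
move=> Lf /(L2Z (-1)) Lg; have := L2D Lf Lg.
by under eq_fun do rewrite mulN1r.
Qed.

Lemma L2_0 : L2 Omega (fun=> 0).
Proof.
split; first exact: measurable_cst.
by rewrite integral0_eq// => x _; rewrite expr0n.
Qed.

Lemma L2_sum (J : Type) (r : seq J) (F : J -> 'rV[R]_n -> R) :
  (forall i, L2 Omega (F i)) -> L2 Omega (fun x => \sum_(i <- r) F i x).
Proof.
move=> LF; elim: r => [|i r IH].
  by under eq_fun do rewrite big_nil; exact: L2_0.
by under eq_fun do rewrite big_cons; exact: L2D.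
Qed.

Lemma integrable_fsum (J : Type) (r : seq J) (P : pred J)
    (F : J -> 'rV[R]_n -> R) :
  (forall i, intble (F i)) -> intble (fun x => \sum_(i <- r | P i) F i x).
Proof.
move=> iF; rewrite (_ : EFin \o _ = (fun x => \sum_(i <- r | P i) (F i x)%:E)%E).
  by apply: integrable_sum => // i _; exact: iF.
by apply/funext => x /=; rewrite sumEFin.
Qed.

Lemma Rintegral_fsum (J : Type) (r : seq J) (P : pred J)
    (F : J -> 'rV[R]_n -> R) :
  (forall i, intble (F i)) ->
  I (fun x => \sum_(i <- r | P i) F i x) = \sum_(i <- r | P i) I (F i).
Proof.
move=> iF; elim: r => [|i r IH].
  under eq_Rintegral do rewrite big_nil.
  by rewrite Rintegral_cst// mul0r big_nil.
under eq_Rintegral do rewrite big_cons.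
rewrite big_cons; case: ifP => // _.
by rewrite RintegralD// ?IH//; exact: integrable_fsum.
Qed.

Lemma L2_bounded f (C : R) : (mu Omega < +oo)%E -> measurable_fun Omega f ->
  (forall x, Omega x -> `|f x| <= C) -> L2 Omega f.
Proof.
move=> fin mf fC; apply: L2_sqrI => //; apply: measurable_bounded_integrable => //.
  exact: measurable_funX.
exists (C ^+ 2); split; first exact: num_real.
move=> y Cy x Ox; apply: (le_trans _ (ltW Cy)) => /=.
rewrite normrX ler_pXn2r ?nnegrE ?fC//.
by apply: le_trans (fC _ Ox).
Qed.

Lemma L2_cst (k : R) : (mu Omega < +oo)%E -> L2 Omega (fun=> k).
Proof. by move=> fin; apply: (@L2_bounded _ `|k|). Qed.

Lemma L2_integrable f : (mu Omega < +oo)%E -> L2 Omega f -> intble f.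
Proof.
move=> fin Lf; have := L2_integrableM Lf (L2_cst 1 fin).
by under eq_fun do rewrite mulr1.
Qed.

Lemma Rintegral_sqr_ge0 f : 0 <= I (fun x => f x ^+ 2).
Proof. by apply: Rintegral_ge0 => x _; exact: sqr_ge0. Qed.

Lemma Rintegral_sqrDZ f g (t : R) : L2 Omega f -> L2 Omega g ->
  I (fun x => (f x + t * g x) ^+ 2) =
  I (fun x => f x ^+ 2) + 2 * t * I (fun x => f x * g x) + t ^+ 2 * I (fun x => g x ^+ 2).
Proof.
move=> Lf Lg.
have iff := L2_integrable_sqr Lf; have igg := L2_integrable_sqr Lg.
have ifg := L2_integrableM Lf Lg.
have i1 := integrable_EFinZ (2 * t) ifg; have i2 := integrable_EFinZ (t ^+ 2) igg.
rewrite -RintegralZl// -RintegralZl// -RintegralD// -RintegralD//; last first.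
  exact: integrable_EFinD.
by apply: eq_Rintegral => x _; ring.
Qed.

(** The quadratic polynomial [t |-> int (f + t g)^2] is nonnegative. *)
Lemma cauchy_schwarz f g : L2 Omega f -> L2 Omega g ->
  I (fun x => f x * g x) ^+ 2 <= I (fun x => f x ^+ 2) * I (fun x => g x ^+ 2).
Proof.
move=> Lf Lg; set A := I (fun x => f x ^+ 2); set B := I (fun x => f x * g x).
set C := I (fun x => g x ^+ 2).
have H t : 0 <= A + 2 * t * B + t ^+ 2 * C.
  by rewrite -Rintegral_sqrDZ//; exact: (@Rintegral_sqr_ge0 (fun x => f x + t * g x)).
have C0 : 0 <= C := Rintegral_sqr_ge0 g.
have [C0'|Cn0] := eqVneq C 0.
  have [->|Bn0] := eqVneq B 0; first by rewrite expr0n/= C0' mulr0.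
  (* The polynomial is affine with slope [2 B]; this is where it equals -1. *)
  have := H (- (A + 1) / (2 * B)); rewrite C0' mulr0 addr0.
  have -> : 2 * (- (A + 1) / (2 * B)) * B = - (A + 1) by field.
  by move=> h; exfalso; lra.
(* [- B / C] is the minimizer. *)
have Cp : 0 < C by rewrite lt0r Cn0.
have := H (- B / C).
have -> : A + 2 * (- B / C) * B + (- B / C) ^+ 2 * C = A - B ^+ 2 / C.
  by field.
by rewrite subr_ge0 ler_pdivrMr.
Qed.

(** Convergence in mean square implies weak convergence, by Cauchy-Schwarz. *)
Lemma L2_cvg_inner (fk : nat -> 'rV[R]_n -> R) f g :
  (forall k, L2 Omega (fk k)) -> L2 Omega f -> L2 Omega g ->
  I (fun x => (fk k x - f x) ^+ 2) @[k --> \oo] --> (0 : R) ->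
  I (fun x => fk k x * g x) @[k --> \oo] --> I (fun x => f x * g x).
Proof.
move=> Lk Lf Lg cv; apply/cvgrPdistC_lt => // e e0 /=.
have G0 := Rintegral_sqr_ge0 g.
have e'0 : 0 < e ^+ 2 / (I (fun x => g x ^+ 2) + 1).
  by rewrite divr_gt0 ?exprn_gt0// ltr_wpDl.
move/cvgr0Pnorm_lt : cv => /(_ _ e'0); apply: filterS => k.
rewrite ger0_norm ?Rintegral_sqr_ge0// => lk.
rewrite -RintegralB//; [|exact: L2_integrableM|exact: L2_integrableM].
under eq_Rintegral do rewrite -mulrBl.
have Lkf := L2B (Lk k) Lf.
have := cauchy_schwarz Lkf Lg => CS.
rewrite -(@ltr_pXn2r _ 2)// ?nnegrE// ?(ltW e0)//.
rewrite real_normK ?num_real//; apply: (le_lt_trans CS).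
rewrite ltr_pdivlMr in lk; last by rewrite ltr_wpDl.
apply: le_lt_trans lk; apply: ler_wpM2l; first exact: Rintegral_sqr_ge0.
by rewrite lerDl.
Qed.

Lemma L2_cvg_sqr (fk : nat -> 'rV[R]_n -> R) f :
  (forall k, L2 Omega (fk k)) -> L2 Omega f ->
  I (fun x => (fk k x - f x) ^+ 2) @[k --> \oo] --> (0 : R) ->
  I (fun x => fk k x ^+ 2) @[k --> \oo] --> I (fun x => f x ^+ 2).
Proof.
move=> Lk Lf cv.
have inner := L2_cvg_inner Lk Lf Lf cv.
rewrite (_ : (fun k => _) = (fun k => I (fun x => (fk k x - f x) ^+ 2) +
   2 * I (fun x => fk k x * f x) - I (fun x => f x * f x))).
  rewrite [X in _ --> X](_ : _ = 0 + 2 * I (fun x => f x * f x) - I (fun x => f x * f x)).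
    apply: cvgB; last exact: cvg_cst.
    by apply: cvgD => //; apply: cvgM => //; exact: cvg_cst.
  rewrite add0r mulr_natl mulr2n addrK; apply: eq_Rintegral => x _.
  by rewrite expr2.
apply/funext => k.
have := Rintegral_sqrDZ (-1) (Lk k) Lf.
have -> : I (fun x => (fk k x + -1 * f x) ^+ 2) = I (fun x => (fk k x - f x) ^+ 2).
  by apply: eq_Rintegral => x _; rewrite mulN1r.
have -> : I (fun x => f x * f x) = I (fun x => f x ^+ 2).
  by apply: eq_Rintegral => x _; rewrite expr2.
move=> ->; ring.
Qed.

End L2_theory.

(** * Ridge functions and test functions *)

Section antiderivative.
Variable R : realType.

(** Only the values of [h] on a segment matter, so [h] is first multiplied by a
    cutoff. The result is integrable on the line, and [t |-> int_(-oo)^t] of it is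
    an antiderivative at every point, with no case distinction on the sign of [t]. *)
Lemma antiderivative_on_segment (h : R -> R) (M : R) : continuous h ->
  exists (h1 H : R -> R), [/\ continuous h1, forall t : R, is_derive t 1 H (h1 t) &
    forall t, `|t| <= M -> h1 t = h t].
Proof.
move=> ch.
pose cut (t : R) : R := Num.max 0 (Num.min 1 (M + 1 - `|t|)).
have ccut : continuous cut.
  move=> t; apply: (@continuous_max _ _ (fun=> 0) (fun t => Num.min 1 (M + 1 - `|t|))).
    exact: cvg_cst.
  apply: (@continuous_min _ _ (fun=> 1) (fun t => M + 1 - `|t|)).
    exact: cvg_cst.
  apply: cvgB; first exact: cvg_cst.
  exact: norm_continuous.
pose h1 t := cut t * h t.
have ch1 : continuous h1 by move=> t; apply: cvgM; [exact: ccut|exact: ch].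
have cut0 t : M + 1 <= `|t| -> h1 t = 0.
  move=> Mt; rewrite /h1 /cut max_l ?mul0r//.
  by rewrite ge_min subr_le0 Mt orbT.
have ih1 : lebesgue_measure.-integrable setT (EFin \o h1).
  have cK : compact `[- (M + 1), M + 1]%classic by exact: segment_compact.
  rewrite (_ : EFin \o h1 = (EFin \o h1) \_ `[- (M + 1), M + 1]%classic).
    apply: (proj1 (integrable_mkcond _ _)) => //.
    apply: continuous_compact_integrable => //.
    exact: continuous_subspaceT.
  apply/funext => t; rewrite patchE; case: ifPn => //; rewrite notin_setE/= in_itv/=.
  by rewrite -ler_norml => /negP; rewrite -ltNge => /ltW /cut0 ->.
exists h1, (fun t => \int[lebesgue_measure]_(s in `]-oo, t]) h1 s); split => //.
  move=> t.
  have [] := @continuous_FTC1 R h1 -oo%O t (t + 1).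
  - by rewrite ltrDl.
  - by apply: integrableS ih1.
  - by rewrite ltNyr.
  - exact: ch1.
  by move=> dF F'; apply: DeriveDef => //; rewrite -derive1E.
move=> t Mt; rewrite /h1 /cut min_l ?max_r ?mul1r//.
by rewrite lerBrDl lerD2r.
Qed.

End antiderivative.

Section ridge.
Variables (R : realType) (n : nat).
Implicit Types (x : 'rV[R]_n) (c : 'I_n -> R).

Definition ridge c x : R := \sum_(j < n) c j * x ord0 j.

Lemma ridge_shift c x (t : R) j :
  ridge c (x + t *: delta_mx ord0 j) = ridge c x + t * c j.
Proof.
rewrite /ridge; under eq_bigr do rewrite !mxE mulrDr eqxx/=.
rewrite big_split/=; congr (_ + _).
rewrite (bigD1 j)//= eqxx mulr1 big1 ?addr0 ?[c j * t]mulrC// => i ij.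
by rewrite (negbTE ij) !mulr0.
Qed.

Lemma rV_continuousD (f g : 'rV[R]_n -> R) : continuous f -> continuous g ->
  continuous (fun x => f x + g x).
Proof. move=> cf cg x; exact: (continuousD (cf x) (cg x)). Qed.

Lemma rV_continuousM (f g : 'rV[R]_n -> R) : continuous f -> continuous g ->
  continuous (fun x => f x * g x).
Proof. move=> cf cg x; exact: (continuousM (cf x) (cg x)). Qed.

Lemma rV_continuous_cst (k : R) : continuous (fun _ : 'rV[R]_n => k).
Proof. exact: cst_continuous. Qed.

Lemma ridge_continuous c : continuous (ridge c).
Proof.
rewrite /ridge; elim: (index_enum _) => [|j r IH].
  by under eq_fun do rewrite big_nil; exact: rV_continuous_cst.
under eq_fun do rewrite big_cons; apply: rV_continuousD IH.
apply: rV_continuousM; first exact: rV_continuous_cst.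
exact: coord_continuous.
Qed.

Lemma continuous_ridge c (h : R -> R) : continuous h ->
  continuous (fun x => h (ridge c x)).
Proof.
by move=> ch x; apply: continuous_comp; [exact: ridge_continuous|exact: ch].
Qed.

Lemma is_derive_line (f : 'rV[R]_n -> R) j x (t : R) :
  derivable f (x + t *: delta_mx ord0 j) (delta_mx ord0 j) ->
  is_derive t 1 (fun s : R => f (x + s *: delta_mx ord0 j))
    (partial j f (x + t *: delta_mx ord0 j)).
Proof.
set e := delta_mx ord0 j; set y := x + t *: e => dy.
have E : (fun h : R =>
    h^-1 *: (((fun s : R => f (x + s *: e)) \o shift t) (h *: 1) - f y)) =
    (fun h : R => h^-1 *: ((f \o shift y) (h *: e) - f y)).
  apply/funext => h /=; congr (_ *: (f _ - _)).
  by rewrite /y [h *: 1]mulr1 scalerDl addrCA.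
by apply: DeriveDef; rewrite /partial /derivable /derive E.
Qed.

End ridge.

Section test_functions.
Variables (R : realType) (n : nat) (Omega : set 'rV[R]_n).
Hypotheses (oO : open Omega) (bO : bounded_set Omega).
Local Notation mu := (lebesgue_rV R n).
Local Notation I f := (Rintegral mu Omega f).
Local Notation intble f := (mu.-integrable Omega (EFin \o f)).
Let mO := open_measurable_rV oO.
Let finO := bounded_lebesgue_fin mO bO.

Lemma test_fun_continuous phi : test_fun Omega phi -> continuous phi.
Proof. by case=> sphi _ _; have [] := sphi [::]. Qed.

Lemma test_fun_partial_continuous phi i : test_fun Omega phi ->
  continuous (partial i phi).
Proof. by case=> sphi _ _; have [] := sphi [:: i]. Qed.

Lemma test_fun_derivable phi i x : test_fun Omega phi ->
  derivable phi x (delta_mx ord0 i).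
Proof. by case=> sphi _ _; have [_] := sphi [::]; apply. Qed.

Lemma test_fun_out phi x : test_fun Omega phi -> ~ Omega x -> phi x = 0.
Proof.
move=> [_ _ sO] Ox; apply/eqP/negPn/negP => phix; apply/Ox/sO.
exact: subset_closure.
Qed.

Lemma test_fun_partial_out phi i x : test_fun Omega phi -> ~ Omega x ->
  partial i phi x = 0.
Proof.
move=> [_ _ sO] Ox.
have : nbhs x (~` closure [set x | phi x != 0]).
  apply: open_nbhs_nbhs; split; first exact/closed_openC/closed_closure.
  by move=> /sO.
move=> /nbhs_ballP[e /= e0 xe].
rewrite /partial (_ : 'D__ phi x = 'D_(delta_mx ord0 i) (cst 0) x).
  exact: derive_cst.
apply: near_eq_derive.
apply/nbhs_ballP; exists e => //= y /xe yO.
by apply/eqP/negPn/negP => phiy; apply/yO/subset_closure.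
Qed.

Lemma bounded_support_L2 (f : 'rV[R]_n -> R) :
  continuous f -> (forall x, ~ Omega x -> f x = 0) -> L2 Omega f.
Proof.
move=> cf f0; have [M M0 OM] := bounded_set_coord bO.
have [||C fC] := @compact_support_bounded R n (M + 1) f.
- exact: cf.
- move=> x i Mi; apply: f0 => /OM/(_ i) Mi'; have := le_trans Mi Mi'.
  by rewrite gerDl ler10.
- apply: (@L2_bounded _ _ _ mO _ C) => //; apply: measurable_funTS.
  exact: continuous_measurable_rV.
Qed.

Lemma test_fun_L2 phi : test_fun Omega phi -> L2 Omega phi.
Proof.
move=> tphi; apply: bounded_support_L2; first exact: test_fun_continuous.
by move=> x; exact: test_fun_out.
Qed.

Lemma test_fun_partial_L2 phi i : test_fun Omega phi -> L2 Omega (partial i phi).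
Proof.
move=> tphi; apply: bounded_support_L2; first exact: test_fun_partial_continuous.
by move=> x; exact: test_fun_partial_out.
Qed.

Lemma continuous_ridge_L2 c (h : R -> R) : continuous h ->
  L2 Omega (fun x => h (ridge c x)).
Proof.
move=> ch; have chr := @continuous_ridge R n c h ch.
have [M M0 OM] := bounded_set_coord bO.
pose K := [set x : 'rV[R]_n | forall i, x ord0 i \in `[- M, M]].
have cK : compact K.
  apply: (@rV_compact _  _ (fun=> `[(- M)%R, M]%classic)).
  by move=> _; apply: segment_compact.
have : compact ((fun x : 'rV[R]_n => h (ridge c x)) @` K).
  by apply: continuous_compact => //; exact: continuous_subspaceT.
move=> /compact_bounded[C [_ dC]].
apply: (@L2_bounded _ _ _ mO _ (`|C| + 1)) => //.
  by apply: measurable_funTS; exact: continuous_measurable_rV.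
move=> x Ox; apply: (dC _ _ (h (ridge c x))).
  by rewrite (le_lt_trans (ler_norm _))// ltrDl.
by exists x => // i; rewrite in_itv/= -ler_norml; exact: OM.
Qed.

(** The integral of the partial derivative of [H(rho) phi] vanishes, and that
    derivative is [c_j h(rho) phi + H(rho) d_j phi]. *)
Lemma test_fun_ridge_ibp c (h H : R -> R) phi j :
  continuous h -> (forall t : R, is_derive t 1 H (h t)) -> test_fun Omega phi ->
  I (fun x => H (ridge c x) * partial j phi x) =
  - (c j * I (fun x => h (ridge c x) * phi x)).
Proof.
move=> ch dH tphi.
have cH : continuous H.
  by move=> t; apply: differentiable_continuous; apply/derivable1_diffP; case: (dH t).
pose psi x := H (ridge c x) * phi x.
pose d x := c j * (h (ridge c x) * phi x) + H (ridge c x) * partial j phi x.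
have cd : continuous d.
  rewrite /d; apply: rV_continuousD; apply: rV_continuousM.
  - exact: rV_continuous_cst.
  - apply: rV_continuousM; first exact: continuous_ridge.
    exact: test_fun_continuous.
  - exact: continuous_ridge.
  - exact: test_fun_partial_continuous.
have dout x : ~ Omega x -> d x = 0.
  move=> Ox; rewrite /d (test_fun_out tphi)// (test_fun_partial_out _ tphi)//.
  by rewrite !mulr0 addr0.
have [M M0 OM] := bounded_set_coord bO.
have Mout (x : 'rV[R]_n) i : M + 1 <= `|x ord0 i| -> ~ Omega x.
  move=> Mi /OM/(_ i) Mi'; have := le_trans Mi Mi'.
  by rewrite gerDl ler10.
have int0 : I d = 0.
  rewrite /Rintegral [X in fine X](_ : _ = 0%E)//.
  rewrite integral_mkcond -[RHS](@integral_partial_eq0 R n j (M + 1) psi d)//.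
  - apply: eq_integral => x _; rewrite patchE; case: ifPn => //.
    by rewrite notin_setE => /dout ->.
  - move=> x t; have dphi := is_derive_line
      (@test_fun_derivable phi j (x + t *: delta_mx ord0 j) tphi).
    rewrite /psi /d.
    under eq_fun do rewrite ridge_shift.
    rewrite !ridge_shift.
    have dr : is_derive t 1 (fun s : R => ridge c x + s * c j) (c j).
      have -> : (fun s : R => ridge c x + s * c j) =
          cst (ridge c x) + (id : R -> R) * cst (c j) by [].
      by apply: is_derive_eq; rewrite add0r scaler0 add0r [_ *: _]mulr1.
    have dHr := @is_derive1_comp R H _ _ _ _ (dH _) dr.
    apply: (is_derive_eq (is_deriveM dHr dphi)).
    have E (a b p q k : R) : a * b + p * (q * k) = k * (q * p) + a * b by ring.
    exact: E.
  - by move=> x i /Mout Ox; rewrite /psi (test_fun_out tphi)// mulr0.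
  - by move=> x i /Mout /dout.
have i1 : intble (fun x => h (ridge c x) * phi x).
  by apply: L2_integrableM => //; [exact: continuous_ridge_L2|exact: test_fun_L2].
have i2 : intble (fun x => H (ridge c x) * partial j phi x).
  by apply: L2_integrableM => //; [exact: continuous_ridge_L2|exact: test_fun_partial_L2].
move: int0; rewrite /d RintegralD//; last exact: integrable_EFinZ.
by rewrite RintegralZl// => /eqP; rewrite addrC addr_eq0 => /eqP.
Qed.

End test_functions.

(** * Passage to the closure of the test functions *)

Section H10_limits.
Variables (R : realType) (n : nat) (Omega : set 'rV[R]_n).
Hypotheses (oO : open Omega) (bO : bounded_set Omega).
Local Notation mu := (lebesgue_rV R n).
Local Notation I f := (Rintegral mu Omega f).
Local Notation intble f := (mu.-integrable Omega (EFin \o f)).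
Let mO := open_measurable_rV oO.

Lemma H10_L2 w Dw : H10 Omega w Dw -> L2 Omega w.
Proof. by move=> [[]]. Qed.

Lemma H10_L2_grad w Dw i : H10 Omega w Dw -> L2 Omega (fun x => Dw x ord0 i).
Proof. by move=> [[]]. Qed.

(** Membership in the closure, coordinate by coordinate and with real integrals:
    each square is bounded by the extended-real integrand that tends to zero. *)
Lemma H10_approx w Dw : H10 Omega w Dw -> exists phi : nat -> 'rV[R]_n -> R,
  [/\ forall k, test_fun Omega (phi k),
      I (fun x => (phi k x - w x) ^+ 2) @[k --> \oo] --> (0 : R)
    & forall i, I (fun x => (partial i (phi k) x - Dw x ord0 i) ^+ 2)
                  @[k --> \oo] --> (0 : R)].
Proof.
move=> Hw; have Lw := H10_L2 Hw; have LDw i := H10_L2_grad i Hw.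
case: Hw => _ [phi [tphi cv]]; exists phi.
pose a k x := (phi k x - w x) ^+ 2.
pose b k i x := (partial i (phi k) x - Dw x ord0 i) ^+ 2.
have ia k : intble (a k).
  exact: (L2_integrable_sqr (L2B mO (test_fun_L2 oO bO (tphi k)) Lw)).
have ib k i : intble (b k i).
  exact: (L2_integrable_sqr (L2B mO (test_fun_partial_L2 oO bO i (tphi k)) (LDw i))).
have iab k : intble (fun x => a k x + \sum_(i < n) b k i x).
  by apply: integrable_EFinD => //; exact: integrable_fsum.
have cvI : I (fun x => a k x + \sum_(i < n) b k i x) @[k --> \oo] --> (0 : R).
  exact: (fine_cvg cv).
have squeeze (g : nat -> 'rV[R]_n -> R) : (forall k, intble (g k)) ->
    (forall k x, 0 <= g k x <= a k x + \sum_(i < n) b k i x) ->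
    I (g k) @[k --> \oo] --> (0 : R).
  move=> ig g0; apply: (squeeze_cvgr _ (cvg_cst 0) cvI).
  apply: nearW => k; rewrite Rintegral_ge0/=; last by move=> x _; case/andP: (g0 k x).
  by apply: le_Rintegral => // x _; case/andP: (g0 k x).
have b0 k x : 0 <= \sum_(i < n) b k i x by apply: sumr_ge0 => i _; exact: sqr_ge0.
split=> //.
  by apply: (squeeze a ia) => k x; rewrite sqr_ge0/= lerDl.
move=> i; apply: (squeeze (fun k => b k i) (fun k => ib k i)) => k x.
rewrite sqr_ge0/= (le_trans _ (_ : \sum_(i < n) b k i x <= _))//.
  by rewrite (bigD1 i)//= lerDl sumr_ge0// => l _; exact: sqr_ge0.
by rewrite lerDr sqr_ge0.
Qed.

Lemma H10_ridge_ibp c (h H : R -> R) w Dw j :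
  continuous h -> (forall t : R, is_derive t 1 H (h t)) -> H10 Omega w Dw ->
  I (fun x => H (ridge c x) * Dw x ord0 j) = - (c j * I (fun x => h (ridge c x) * w x)).
Proof.
move=> ch dH Hw; have [phi [tphi cvphi cvD]] := H10_approx Hw.
have cH : continuous H.
  by move=> t; apply: differentiable_continuous; apply/derivable1_diffP; case: (dH t).
have LH := continuous_ridge_L2 oO bO c cH.
have Lh := continuous_ridge_L2 oO bO c ch.
have c1 := L2_cvg_inner mO (fun k => test_fun_partial_L2 oO bO j (tphi k))
  (H10_L2_grad j Hw) LH (cvD j).
have c2 := L2_cvg_inner mO (fun k => test_fun_L2 oO bO (tphi k))
  (H10_L2 Hw) Lh cvphi.
have c3 : - (c j * I (fun x => phi k x * h (ridge c x))) @[k --> \oo] -->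
    - (c j * I (fun x => w x * h (ridge c x))).
  by apply: cvgN; apply: cvgM => //; exact: cvg_cst.
have comm (f g : 'rV[R]_n -> R) : I (fun x => f x * g x) = I (fun x => g x * f x).
  by apply: eq_Rintegral => x _; rewrite mulrC.
rewrite comm [in RHS]comm.
apply: (cvg_unique _ c1); first exact: Rhausdorff.
have E : (fun k => I (fun x => partial j (phi k) x * H (ridge c x))) =
  (fun k => - (c j * I (fun x => phi k x * h (ridge c x)))).
  apply/funext => k; rewrite comm (test_fun_ridge_ibp oO bO c j ch dH (tphi k)).
  by rewrite [in RHS]comm.
by rewrite E.
Qed.

Lemma ridge_bound c : exists M : R, forall x, Omega x -> `|ridge c x| <= M.
Proof.
have [M M0 OM] := bounded_set_coord bO.
exists (\sum_(j < n) `|c j| * M) => x Ox.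
apply: (le_trans (ler_norm_sum _ _ _)); apply: ler_sum => j _.
by rewrite normrM ler_wpM2l// OM.
Qed.

Lemma Rintegral_ae_eq (f g : 'rV[R]_n -> R) :
  measurable_fun Omega f -> measurable_fun Omega g ->
  {ae mu, forall x, Omega x -> f x = g x} -> I f = I g.
Proof.
move=> mf mg fg; congr fine; apply: ae_eq_integral => //.
- exact/measurable_EFinP.
- exact/measurable_EFinP.
by apply: filterS fg => x fgx Ox /=; rewrite fgx.
Qed.

Lemma H10_vec_L2 v Dv i j : H10_vec Omega v Dv -> L2 Omega (fun x => Dv x i j).
Proof.
move=> /(_ i) /(H10_L2_grad j).
by under eq_fun do rewrite mxE.
Qed.

(** Both [v] and the field [w c] satisfy the identity
    [int H(rho) div v = - int h(rho) <c, v>], where [rho = ridge c]; as the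
    divergence of [v] is [l] times that of [w c], the right-hand sides are in the
    same ratio. [H] is a primitive of [h] on the bounded range of [rho] only. *)
Lemma divergence_ridge c (h : R -> R) v Dv w Dw (l : R) :
  continuous h -> H10_vec Omega v Dv -> H10 Omega w Dw ->
  {ae mu, forall x, Omega x -> \tr (Dv x) = l * ridge c (Dw x)} ->
  I (fun x => h (ridge c x) * ridge c (v x)) =
  l * (\sum_(j < n) c j ^+ 2) * I (fun x => h (ridge c x) * w x).
Proof.
move=> ch Hv Hw trDv.
have [M OM] := ridge_bound c.
have [h1 [H [ch1 dH h1h]]] := antiderivative_on_segment M ch.
have cH : continuous H.
  by move=> t; apply: differentiable_continuous; apply/derivable1_diffP; case: (dH t).
have hE (f : 'rV[R]_n -> R) :
    I (fun x => h (ridge c x) * f x) = I (fun x => h1 (ridge c x) * f x).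
  by apply: eq_Rintegral => x; rewrite inE => Ox; rewrite h1h// OM.
have LH := continuous_ridge_L2 oO bO c cH.
have Lh := continuous_ridge_L2 oO bO c ch1.
have LDv i j : L2 Omega (fun x => Dv x i j) := H10_vec_L2 i j Hv.
have LDw j := H10_L2_grad j Hw.
have Ltr : L2 Omega (fun x => \tr (Dv x)) by apply: L2_sum.
have Lrw : L2 Omega (fun x => l * ridge c (Dw x)).
  by apply: L2Z => //; apply: L2_sum => // i; exact: L2Z.
have Hi : I (fun x => H (ridge c x) * \tr (Dv x)) =
          I (fun x => H (ridge c x) * (l * ridge c (Dw x))).
  apply: Rintegral_ae_eq.
  - by apply: measurable_funM; exact: L2_measurable.
  - by apply: measurable_funM; exact: L2_measurable.
  - by apply: filterS trDv => x E Ox; rewrite E.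
have lhs : I (fun x => H (ridge c x) * \tr (Dv x)) =
    - I (fun x => h1 (ridge c x) * ridge c (v x)).
  under eq_Rintegral do rewrite mulr_sumr.
  rewrite (Rintegral_fsum mO)//; last by move=> i; exact: L2_integrableM.
  rewrite (eq_bigr (fun j =>
    - (c j * I (fun x => h1 (ridge c x) * v x ord0 j)))); last first.
    move=> j _; rewrite -(H10_ridge_ibp c j ch1 dH (Hv j)).
    by apply: eq_Rintegral => x _; rewrite mxE.
  rewrite sumrN; congr (- _).
  under [RHS]eq_Rintegral do rewrite mulr_sumr.
  rewrite (Rintegral_fsum mO); last first.
    by move=> j; apply: L2_integrableM => //; apply: L2Z => //; exact: H10_L2 (Hv j).
  apply: eq_bigr => j _; rewrite -RintegralZl//; last first.
    by apply: L2_integrableM => //; exact: H10_L2 (Hv j).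
  by apply: eq_Rintegral => x _; rewrite mulrCA.
have rhs : I (fun x => H (ridge c x) * (l * ridge c (Dw x))) =
    - (l * (\sum_(j < n) c j ^+ 2) * I (fun x => h1 (ridge c x) * w x)).
  transitivity (I (fun x => l * \sum_(j < n) c j * (H (ridge c x) * Dw x ord0 j))).
    apply: eq_Rintegral => x _; rewrite mulrCA; congr (_ * _); rewrite mulr_sumr.
    by apply: eq_bigr => j _; rewrite mulrCA.
  rewrite RintegralZl//; last first.
    apply: integrable_fsum => // j; apply: integrable_EFinZ => //.
    exact: L2_integrableM.
  rewrite (Rintegral_fsum mO); last first.
    by move=> j; apply: integrable_EFinZ => //; exact: L2_integrableM.
  rewrite -mulrA -mulrN; congr (_ * _); rewrite mulr_suml -sumrN.
  apply: eq_bigr => j _; rewrite RintegralZl//; last exact: L2_integrableM.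
  by rewrite (H10_ridge_ibp c j ch1 dH Hw) expr2 mulrN mulrA.
by apply/eqP; rewrite !hE -(inj_eq (@oppr_inj _)) -lhs -rhs; exact/eqP.
Qed.

End H10_limits.

(** * From continuous to measurable functions of one coordinate *)

Import HBNNSimple.

Section one_variable.
Variables (R : realType) (n : nat) (Omega : set 'rV[R]_n) (i : 'I_n).
Hypotheses (oO : open Omega) (bO : bounded_set Omega).
Local Notation mu := (lebesgue_rV R n).
Local Notation I f := (Rintegral mu Omega f).
Local Notation intble f := (mu.-integrable Omega (EFin \o f)).
Let mO := open_measurable_rV oO.
Let finO := bounded_lebesgue_fin mO bO.

(** Vanishing of an integral is stable under dominated pointwise limits; this carries
    the identity [int h(x_i) F = 0] from continuous [h] to measurable [h]. *)
Lemma Rintegral_dominated_eq0 (fk : nat -> 'rV[R]_n -> R) (f g : 'rV[R]_n -> R) :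
  (forall k, measurable_fun Omega (fk k)) -> measurable_fun Omega f ->
  (forall x, Omega x -> fk k x @[k --> \oo] --> f x) -> intble g ->
  (forall k x, Omega x -> `|fk k x| <= g x) ->
  (forall k, I (fk k) = 0) -> I f = 0.
Proof.
move=> mfk mf cv ig fg I0.
have ifk k : intble (fk k).
  apply: (le_integrable mO _ _ ig); first exact/measurable_EFinP.
  by move=> x Ox; rewrite lee_fin (le_trans (fg _ _ Ox))// ler_norm.
have [] := @dominated_convergence _ _ R mu Omega mO (fun k => EFin \o fk k)
  (EFin \o f) (EFin \o g).
- by move=> k; exact/measurable_EFinP.
- exact/measurable_EFinP.
- by apply: aeW => x Ox; apply: cvg_EFin; [exact: nearW|exact: cv].
- exact: ig.
- by apply: aeW => x k Ox; rewrite lee_fin fg.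
move=> _ _ cvI; rewrite /Rintegral.
have E : (fun k => \int[mu]_(x in Omega) (EFin \o fk k) x)%E = (fun=> 0%:E)%E.
  apply/funext => k; rewrite -[LHS]fineK; last exact: integrable_fin_num.
  by congr EFin; exact: I0.
rewrite E in cvI.
have -> : (\int[mu]_(x in Omega) (f x)%:E = 0)%E; last by [].
by apply: (cvg_unique _ cvI) => //; exact: cvg_cst.
Qed.

Section null_on_continuous.
Variable F : 'rV[R]_n -> R.
Hypothesis LF : L2 Omega F.
Hypothesis F_cont : forall h : R -> R, continuous h ->
  I (fun x => h (x ord0 i) * F x) = 0.

Let mF := L2_measurable LF.
Let iF := L2_integrable mO finO LF.

Let null (B : set R) := I (fun x => \1_B (x ord0 i) * F x) = 0.

Lemma measurable_coord_comp (f : R -> R) : measurable_fun setT f ->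
  measurable_fun Omega (fun x => f (x ord0 i)).
Proof.
move=> mf; apply: measurable_funTS; apply: measurableT_comp => //.
exact: measurable_coord.
Qed.

Let measurable_coordF (f : R -> R) : measurable_fun setT f ->
  measurable_fun Omega (fun x => f (x ord0 i) * F x).
Proof. by move=> mf; apply: measurable_funM => //; exact: measurable_coord_comp. Qed.

Let inormF : intble (fun x => `|F x|).
Proof. exact: integrable_norm. Qed.

Let intble_indicF (B : set R) : measurable B ->
  intble (fun x : 'rV[R]_n => \1_B (x ord0 i) * F x).
Proof.
move=> mB; apply: (le_integrable mO _ _ inormF).
  by apply/measurable_EFinP; exact: measurable_coordF.
move=> x Ox; rewrite lee_fin/= normrM normr_id ler_piMl//.
by rewrite indicE; case: (_ \in _); rewrite ?normr0 ?normr1.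
Qed.

(** The indicator of an open ray is the pointwise limit of continuous ramps of
    increasing slope. *)
Let null_ray (a : R) : null `]a, +oo[%classic.
Proof.
pose h (k : nat) (t : R) : R := Num.max 0 (Num.min 1 (k%:R * (t - a))).
have ch k : continuous (h k).
  move=> t; apply: (@continuous_max _ _ (fun=> 0) (fun t => Num.min 1 (k%:R * (t - a)))).
    exact: cvg_cst.
  apply: (@continuous_min _ _ (fun=> 1) (fun t => k%:R * (t - a))).
    exact: cvg_cst.
  apply: cvgM; first exact: cvg_cst.
  by apply: cvgB; [exact: cvg_id|exact: cvg_cst].
have h01 k t : 0 <= h k t <= 1.
  by rewrite le_max lexx/= ge_max ler01/= ge_min lexx.
apply: (@Rintegral_dominated_eq0 (fun k x => h k (x ord0 i) * F x) _ (fun x => `|F x|)).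
- by move=> k; apply: measurable_coordF; exact: continuous_measurable_fun.
- exact: measurable_coordF.
- move=> x _; apply: cvgM; last exact: cvg_cst.
  rewrite indicE; set t := x ord0 i.
  have [ta|ta] := leP t a.
    rewrite memNset/=; last by rewrite in_itv/= andbT ltNge ta.
    apply: cvg_near_cst; apply: nearW => k.
    rewrite /h max_l// ge_min; apply/orP; right.
    by rewrite mulr_ge0_le0// subr_le0.
  rewrite mem_set/=; last by rewrite in_itv/= andbT.
  apply: cvg_near_cst; near=> k.
  rewrite /h; have le1 : 1 <= k%:R * (t - a).
    rewrite -ler_pdivrMr ?subr_gt0// div1r.
    by near: k; exact: nbhs_infty_ger.
  by rewrite min_l// max_r.
- exact: inormF.
- move=> k x _; rewrite normrM ler_piMl//.
  by have /andP[h0 h1] := h01 k (x ord0 i); rewrite ger0_norm.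
- by move=> k; exact: F_cont.
Unshelve. all: by end_near. Qed.

(** Open rays form an intersection-stable family generating the Borel sets, and
    the sets on which the integral vanishes are closed under complements and
    disjoint countable unions. *)
Let null_measurable (E : set R) : measurable E -> null E.
Proof.
move=> mE; apply: (@dynkin_induction _ R (@RGenOInfty.G R) null).
- exact: RGenOInfty.measurableE.
- move=> _ _ [x ->] [y ->]; exists (Num.max x y).
  apply/seteqP; split => t /=; rewrite !in_itv/= !andbT gt_max.
    by move=> [-> ->].
  by move=> /andP[].
- rewrite /null; under eq_Rintegral do rewrite indicT.
  by apply: (@F_cont (fun=> 1)); exact: cst_continuous.
- by move=> _ [x ->]; exact: null_ray.
- move=> S mS NS; rewrite /null.
  transitivity (I (fun x => 1 * F x - \1_S (x ord0 i) * F x)).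
    apply: eq_Rintegral => x _; rewrite -mulrBl; congr (_ * _).
    by rewrite !indicE in_setC; case: (_ \in S); rewrite ?subrr ?subr0.
  rewrite RintegralB// ?NS ?subr0; last 2 first.
    by under eq_fun do rewrite mul1r.
    exact: intble_indicF.
  by apply: (@F_cont (fun=> 1)); exact: cst_continuous.
- move=> B mB tB NB.
  have ind0 t m : ~ (\bigcup_k B k) t -> \sum_(k < m) \1_(B k) t = 0 :> R.
    move=> tB'; rewrite big1// => k _; rewrite indicE memNset// => Bkt.
    by apply: tB'; exists k.
  (* At most one of the disjoint sets [B l] contains [t]. *)
  have ind1 t k m : B k t -> \sum_(l < m) \1_(B l) t = (k < m)%:R :> R.
    move=> Bkt; elim: m => [|m IH]; first by rewrite big_ord0.
    rewrite big_ord_recr/= IH indicE ltnS [in RHS]leq_eqVlt.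
    have [<-|km] := eqVneq k m; first by rewrite ltnn add0r mem_set.
    rewrite memNset ?addr0// => Bmt; move/eqP : km; apply.
    by apply: tB => //; exists t.
  apply: (@Rintegral_dominated_eq0
    (fun m x => (\sum_(k < m) \1_(B k) (x ord0 i)) * F x) _ (fun x => `|F x|)).
  - move=> m; apply: (@measurable_coordF (fun t => \sum_(k < m) \1_(B k) t)).
    by apply: measurable_sum => k; exact: measurable_indic.
  - by apply: measurable_coordF; apply: measurable_indic; exact: bigcup_measurable.
  - move=> x _; apply: cvgM; last exact: cvg_cst.
    have [[k _ Bkx]|nBx] := pselect ((\bigcup_k B k) (x ord0 i)).
      rewrite indicE mem_set/=; last by exists k.
      apply: cvg_near_cst; near=> m; rewrite (ind1 _ _ _ Bkx).
      by rewrite (_ : (k < m)%N = true)//; near: m; exact: nbhs_infty_gt.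
    rewrite indicE memNset//=; apply: cvg_near_cst; apply: nearW => m.
    exact: ind0.
  - exact: inormF.
  - move=> m x _; rewrite normrM ler_piMl//.
    have [[k _ Bkx]|nBx] := pselect ((\bigcup_k B k) (x ord0 i)).
      by rewrite (ind1 _ _ _ Bkx); case: (k < m)%N; rewrite ?normr0 ?normr1.
    by rewrite ind0// normr0.
  - move=> m; under eq_Rintegral do rewrite mulr_suml.
    rewrite (Rintegral_fsum mO); last by move=> k; exact: intble_indicF.
    by rewrite big1// => k _; exact: NB.
- suff : (@RGenOInfty.G R).-sigma.-measurable E by [].
  by rewrite -RGenOInfty.measurableE.
Unshelve. all: by end_near. Qed.

Let null_nonneg (f : R -> R) : measurable_fun setT f -> (forall t, 0 <= f t) ->
  L2 Omega (fun x => f (x ord0 i)) -> I (fun x => f (x ord0 i) * F x) = 0.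
Proof.
move=> mf f0 Lf.
have mEf : measurable_fun setT (EFin \o f) by exact/measurable_EFinP.
pose fk := nnsfun_approx measurableT mEf.
have cvf t : fk k t @[k --> \oo] --> f t.
  have Tt : [set: R] t by [].
  exact: (fine_cvg (cvg_nnsfun_approx measurableT mEf (fun t _ => f0 t) Tt)).
have fkf k t : fk k t <= f t.
  have nd : nondecreasing_seq (fun k => fk k t).
    by move=> a b ab; have /lefP := nd_nnsfun_approx measurableT mEf ab; apply.
  rewrite -(cvg_lim _ (cvf t))//.
  apply: (nondecreasing_cvgn_le nd); apply/cvg_ex; exists (f t); exact: cvf.
have ifF := L2_integrableM mO Lf LF.
apply: (@Rintegral_dominated_eq0 (fun k x => fk k (x ord0 i) * F x) _
  (fun x => `|f (x ord0 i) * F x|)).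
- by move=> k; exact: measurable_coordF.
- exact: measurable_coordF.
- by move=> x _; apply: cvgM; [exact: cvf|exact: cvg_cst].
- exact: integrable_norm.
- move=> k x _; rewrite !normrM ler_wpM2r// !ger0_norm//.
- move=> k; under eq_Rintegral => x _.
    rewrite fimfunE fsbig_finite//= mulr_suml.
    under eq_bigr do rewrite -mulrA.
    over.
  have im (r : R) : intble (fun x : 'rV[R]_n =>
      r * (\1_(fk k @^-1` [set r]) (x ord0 i) * F x)).
    by apply: integrable_EFinZ => //; exact: intble_indicF.
  rewrite (Rintegral_fsum mO)//.
  rewrite big1// => r _; rewrite RintegralZl//; last exact: intble_indicF.
  by rewrite [X in _ * X]null_measurable ?mulr0.
Qed.

(** Positive and negative parts are dominated by [|f|], so each of them can be
    treated as an increasing limit of simple functions. *)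
Lemma null_measurable_fun (f : R -> R) : measurable_fun setT f ->
  L2 Omega (fun x => f (x ord0 i)) -> I (fun x => f (x ord0 i) * F x) = 0.
Proof.
move=> mf Lf.
pose fp t := Num.max (f t) 0; pose fn t := Num.max (- f t) 0.
have mfp : measurable_fun setT fp by exact: measurable_maxr.
have mfn : measurable_fun setT fn.
  by apply: measurable_maxr => //; exact: measurableT_comp.
have Lp (g : R -> R) : measurable_fun setT g -> (forall t, `|g t| <= `|f t|) ->
    L2 Omega (fun x => g (x ord0 i)).
  move=> mg gf; have mgO := measurable_coord_comp mg.
  apply: (@L2_sqrI _ _ _ mO (fun x => g (x ord0 i))) => //.
  apply: (le_integrable mO _ _ (L2_integrable_sqr Lf)).
    by apply/measurable_EFinP; exact: measurable_funX.
  by move=> x _ /=; rewrite lee_fin !normrX lerXn2r ?nnegrE.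
have Lfp : L2 Omega (fun x => fp (x ord0 i)).
  by apply: Lp => // t; rewrite /fp; case: (leP (f t) 0); rewrite ?normr0.
have Lfn : L2 Omega (fun x => fn (x ord0 i)).
  by apply: Lp => // t; rewrite /fn; case: (leP (- f t) 0); rewrite ?normr0 ?normrN.
transitivity (I (fun x => fp (x ord0 i) * F x - fn (x ord0 i) * F x)).
  apply: eq_Rintegral => x _; rewrite -mulrBl; congr (_ * _).
  rewrite /fp /fn; case: (leP (f (x ord0 i)) 0) => fx.
    by rewrite max_l ?oppr_ge0// sub0r opprK.
  by rewrite max_r ?subr0// oppr_le0 ltW.
rewrite RintegralB//; [|exact: L2_integrableM|exact: L2_integrableM].
rewrite null_nonneg ?null_nonneg ?subrr//.
- by move=> t; rewrite /fn le_max lexx orbT.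
- by move=> t; rewrite /fp le_max lexx orbT.
Qed.

End null_on_continuous.

(** The profile [gamma] of [g] is arbitrary off the projection of the domain, where
    it is replaced by zero. On the projection it is measurable: the domain is a
    countable union of rational balls, and over the shadow of such a ball [gamma]
    is [g] read along a segment parallel to the [i]-th axis through the centre. *)
Lemma depends_only_on_measurable (g : 'rV[R]_n -> R) :
  measurable_fun Omega g -> depends_only_on Omega i g ->
  exists2 f : R -> R, measurable_fun setT f &
    forall x, Omega x -> g x = f (x ord0 i).
Proof.
move=> mg [gamma gE].
pose proj : set R := [set x ord0 i | x in Omega].
have mproj (Y : set R) : measurable Y -> measurable (proj `&` gamma @^-1` Y).
  move=> mY.
  (* The centre of the ball [p], with its [i]-th coordinate moved to [t]. *)
  pose upd (p : 'rV[rat]_n * nat) (t : R) : 'rV[R]_n :=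
    \row_l (if l == i then t else ratr (p.1 ord0 l)).
  have -> : proj `&` gamma @^-1` Y =
      \bigcup_(p in [set p | rat_ball p `<=` Omega]) (upd p @^-1` (Omega `&` g @^-1` Y)).
    apply/seteqP; split => t.
      move=> [[x Ox <-{t}] /= Yx].
      have : Omega x by [].
      rewrite {1}(open_bigcup_rat_ball oO) => -[p /= pO]; rewrite rat_ballE/= => px.
      have Ou : Omega (upd p (x ord0 i)).
        apply: pO; rewrite rat_ballE => l; rewrite mxE; case: eqP => [->|_].
          exact: px.
        by rewrite subrr normr0 invr_gt0.
      by exists p => //=; split=> //; rewrite gE// mxE eqxx.
    move=> [p /= pO [Ou Yu]]; split=> /=.
      by exists (upd p t) => //; rewrite mxE eqxx.
    by move: Yu; rewrite gE// mxE eqxx.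
  apply: bigcup_rat_ball_measurable => p _.
  rewrite -[X in measurable X]setTI.
  have mu : measurable_fun setT (upd p).
    apply: measurable_fun_rV => l; under eq_fun do rewrite mxE.
    by case: eqP => _; [exact: measurable_id|exact: measurable_cst].
  by apply: mu => //; exact: mg.
have mp : measurable proj.
  by have := mproj setT measurableT; rewrite preimage_setT setIT.
exists (gamma \_ proj).
  apply: (proj1 (measurable_restrictT _ mp)).
  by move=> _ Y mY; exact: mproj.
by move=> x Ox; rewrite patchE mem_set ?gE//; exists x.
Qed.

End one_variable.

(** * Lower bound from a weak solution with ridge data *)

Section bogovskii_bounds.
Variables (R : realType) (n : nat) (Omega : set 'rV[R]_n).
Hypotheses (oO : open Omega) (bO : bounded_set Omega).
Local Notation mu := (lebesgue_rV R n).
Local Notation I f := (Rintegral mu Omega f).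
Local Notation intble f := (mu.-integrable Omega (EFin \o f)).
Let mO := open_measurable_rV oO.
Let finO := bounded_lebesgue_fin mO bO.

Lemma integral_RintegralE (f : 'rV[R]_n -> R) : intble f ->
  (\int[mu]_(x in Omega) (f x)%:E = (I f)%:E)%E.
Proof. by move=> fi; rewrite /Rintegral fineK//; exact: integrable_fin_num. Qed.

Lemma integrable_Dv2 v (Dv : 'rV[R]_n -> 'M[R]_n) : H10_vec Omega v Dv ->
  intble (fun x => \sum_(i < n) \sum_(j < n) Dv x i j ^+ 2).
Proof.
move=> Hv; apply: integrable_fsum => // i; apply: integrable_fsum => // j.
by apply: L2_integrable_sqr; exact: H10_vec_L2 Hv.
Qed.

(** Reduction to a zero-mean datum [d] of arbitrary positive norm: the admissible
    right-hand side is [l d] with [l = 1 / |d|]. *)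
Lemma bogovskii_normalized_ge (d : 'rV[R]_n -> R) (a : R) :
  L2 Omega d -> I d = 0 -> 0 < I (fun x => d x ^+ 2) ->
  (forall v Dv l, H10_vec Omega v Dv -> 0 < l ->
     l ^+ 2 * I (fun x => d x ^+ 2) = 1 ->
     {ae mu, forall x, Omega x -> \tr (Dv x) = l * d x} ->
     a <= I (fun x => \sum_(i < n) \sum_(j < n) Dv x i j ^+ 2)) ->
  (a%:E <= bogovskii Omega)%E.
Proof.
move=> Ld Id0 N0 H.
pose l := (Num.sqrt (I (fun x => d x ^+ 2)))^-1.
have l0 : 0 < l by rewrite invr_gt0 sqrtr_gt0.
have lN : l ^+ 2 * I (fun x => d x ^+ 2) = 1.
  by rewrite exprVn sqr_sqrtr ?ltW// mulVf// gt_eqF.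
pose f x := l * d x.
have Lf : L2 Omega f by exact: L2Z.
have i_f : intble f by exact: L2_integrable.
have f2 : (\int[mu]_(x in Omega) (f x ^+ 2)%:E = 1)%E.
  rewrite integral_RintegralE; last exact: L2_integrable_sqr.
  congr EFin; rewrite -lN -RintegralZl//; last exact: L2_integrable_sqr.
  by apply: eq_Rintegral => x _; rewrite exprMn.
apply: (@le_trans _ _ (ereal_inf [set (\int[mu]_(x in Omega)
              (\sum_(i < n) \sum_(j < n) Dv x i j ^+ 2)%:E)%E
        | Dv in [set Dv | exists v, H10_vec Omega v Dv /\
                  {ae mu, forall x, Omega x -> \tr (Dv x) = f x}]])).
  apply: le_ereal_inf_tmp => _ [Dv [v [Hv trDv]] <-].
  by rewrite integral_RintegralE ?lee_fin; [exact: H trDv|exact: integrable_Dv2 Hv].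
apply: ereal_sup_ubound; exists f => //; split=> //; split=> //.
rewrite integral_RintegralE// RintegralZl ?Id0 ?mulr0//.
exact: L2_integrable.
Qed.

Lemma test_fun0 : test_fun Omega (fun=> 0).
Proof.
have p0 (s : seq 'I_n) : foldr (@partial R n) (fun=> 0) s = (fun=> 0).
  elim: s => //= i s ->; apply/funext => x; rewrite /partial.
  exact: derive_cst.
split.
- move=> s; rewrite p0; split; first exact: cst_continuous.
  by move=> i x; exact: derivable_cst.
- rewrite (_ : mkset _ = set0) ?closure0; first exact: compact0.
  by apply/seteqP; split=> x //=; rewrite eqxx.
- rewrite (_ : mkset _ = set0) ?closure0//.
  by apply/seteqP; split=> x //=; rewrite eqxx.
Qed.

Lemma H10_0 : H10 Omega (fun=> 0) (fun=> 0).
Proof.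
split.
  split; first exact: L2_0.
    by move=> i; under eq_fun do rewrite mxE; exact: L2_0.
  move=> phi i _; rewrite !integral0_eq ?oppe0// => x _; rewrite ?mxE mul0r//.
exists (fun _ _ => 0); split; first by move=> _; exact: test_fun0.
rewrite (_ : (fun k => _) = (fun=> 0%E)); first exact: cvg_cst.
apply/funext => k; apply: integral0_eq => x _.
rewrite subrr expr0n/= add0r big1// => i _.
rewrite mxE subr0 /partial (_ : 'D__ _ x = 0) ?expr0n//.
exact: derive_cst.
Qed.

Lemma H10_vec_0 : H10_vec Omega (fun=> 0) (fun=> 0).
Proof.
move=> i; have := H10_0.
rewrite (_ : (fun x : 'rV[R]_n => row i 0) = (fun=> 0)); last first.
  by apply/funext => x; apply/rowP => j; rewrite !mxE.
by rewrite (_ : (fun x : 'rV[R]_n => (0 : 'rV[R]_n) ord0 i) = (fun=> 0))//;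
  apply/funext => x; rewrite mxE.
Qed.

Definition grad_energy (Dw : 'rV[R]_n -> 'rV[R]_n) : R :=
  I (fun x => \sum_(j < n) Dw x ord0 j ^+ 2).

(** The hypothesis [gridge] is the form in which a ridge function [g] enters: the
    divergence of a field [v] determines [int g <c, v>], with the field [l w c] as
    the reference. *)
Section ridge_ratio.
Variables (c : 'I_n -> R) (g w : 'rV[R]_n -> R) (Dw : 'rV[R]_n -> 'rV[R]_n).
Hypotheses (Lg : L2 Omega g) (wsol : weak_solution Omega g w Dw).
Hypothesis gridge : forall v Dv (l : R), H10_vec Omega v Dv ->
  {ae mu, forall x, Omega x -> \tr (Dv x) = l * ridge c (Dw x)} ->
  I (fun x => g x * ridge c (v x)) =
  l * (\sum_(j < n) c j ^+ 2) * I (fun x => g x * w x).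
Hypothesis c0 : 0 < \sum_(j < n) c j ^+ 2.
Hypothesis W0 : 0 < grad_energy Dw.

Let Hw : H10 Omega w Dw. Proof. by case: wsol. Qed.
Let LDw j := H10_L2_grad j Hw.

Let LcDw : L2 Omega (fun x => ridge c (Dw x)).
Proof. by apply: L2_sum => // j; exact: L2Z. Qed.

Let weak_eq phi Dphi : H10 Omega phi Dphi ->
  I (fun x => \sum_(i < n) Dw x ord0 i * Dphi x ord0 i) = I (fun x => g x * phi x).
Proof. by move=> Hphi; rewrite /Rintegral (wsol.2 _ _ Hphi). Qed.

Let gwE : I (fun x => g x * w x) = grad_energy Dw.
Proof.
rewrite -(weak_eq Hw); apply: eq_Rintegral => x _.
by apply: eq_bigr => i _; rewrite expr2.
Qed.

(** If [<c, grad w>] vanished, the zero field would have divergence [<c, grad w>],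
    and [gridge] would give [int g w = 0], that is [grad w = 0]. *)
Lemma ridge_energy_gt0 : 0 < I (fun x => ridge c (Dw x) ^+ 2).
Proof.
rewrite lt0r Rintegral_sqr_ge0 andbT; apply/eqP => N0.
have ae0 : {ae mu, forall x, Omega x -> \tr (0 : 'M[R]_n) = 1 * ridge c (Dw x)}.
  have : ae_eq mu Omega (fun x => (ridge c (Dw x) ^+ 2)%:E) (cst 0%E).
    apply: (proj1 (ae_eq_integral_abs _ mO _)).
      by apply/measurable_EFinP; apply: measurable_funX; exact: L2_measurable.
    under eq_integral => x _ do rewrite /= ger0_norm ?sqr_ge0//.
    by rewrite integral_RintegralE ?N0//; exact: L2_integrable_sqr.
  apply: filterS => x h Ox; move: (h Ox) => [] /eqP; rewrite sqrf_eq0 => /eqP ->.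
  by rewrite mxtrace0 mulr0.
have := gridge H10_vec_0 ae0; rewrite mul1r gwE.
under eq_Rintegral => x _.
  rewrite /ridge big1 ?mulr0; last by move=> j _; rewrite mxE mulr0.
  over.
rewrite Rintegral_cst// mul0r => /esym/eqP.
by rewrite mulf_eq0 !gt_eqF.
Qed.

Lemma mean_ridge_grad : I (fun x => ridge c (Dw x)) = 0.
Proof.
rewrite (Rintegral_fsum mO); last first.
  by move=> j; apply: L2_integrable => //; exact: L2Z.
rewrite big1// => j _; rewrite RintegralZl//; last exact: L2_integrable.
have d1 (t : R) : is_derive t 1 (cst (1 : R)) (0 : R) by exact: is_derive_cst.
have := H10_ridge_ibp oO bO c j (@cst_continuous _ _ (0 : R)) d1 Hw.
under eq_Rintegral do rewrite mul1r.
move=> ->; under eq_Rintegral do rewrite mul0r.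
by rewrite Rintegral_cst// mul0r mulr0 oppr0 mulr0.
Qed.

(** [p] below is the pointwise inner product of [Dv] with [c (x) Dw] and [q] is
    the squared norm of [c (x) Dw]; the bound is the integrated form of
    [|Dv|^2 >= 2 l p - l^2 q]. *)
Theorem bogovskii_ge_ridge_ratio :
  (((\sum_(j < n) c j ^+ 2) * grad_energy Dw / I (fun x => ridge c (Dw x) ^+ 2))%:E
    <= bogovskii Omega)%E.
Proof.
have N0 := ridge_energy_gt0.
set C := \sum_(j < n) c j ^+ 2; set W := grad_energy Dw.
apply: (bogovskii_normalized_ge LcDw mean_ridge_grad N0) => v Dv l Hv l0 lN trDv.
set N := I (fun x => ridge c (Dw x) ^+ 2) in lN *.
have LDv i j : L2 Omega (fun x => Dv x i j) := H10_vec_L2 i j Hv.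
have -> : C * W / N = l ^+ 2 * (C * W).
  apply: (@mulIf _ N); first by rewrite gt_eqF.
  by rewrite mulfVK ?gt_eqF// mulrAC lN mul1r.
pose p x := \sum_(i < n) c i * \sum_(j < n) Dw x ord0 j * Dv x i j.
pose q x := \sum_(i < n) c i ^+ 2 * \sum_(j < n) Dw x ord0 j ^+ 2.
have i1 i : intble (fun x => \sum_(j < n) Dw x ord0 j * Dv x i j).
  by apply: integrable_fsum => // j; exact: L2_integrableM.
have i2 : intble (fun x => \sum_(j < n) Dw x ord0 j ^+ 2).
  by apply: integrable_fsum => // j; exact: L2_integrable_sqr.
have ip : intble p by apply: integrable_fsum => // i; exact: integrable_EFinZ.
have iq : intble q by apply: integrable_fsum => // i; exact: integrable_EFinZ.
have pE : I p = l * (C * W).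
  rewrite (Rintegral_fsum mO); last by move=> i; exact: integrable_EFinZ.
  rewrite mulrA /W -gwE -(gridge Hv trDv).
  transitivity (I (fun x => \sum_(i < n) c i * (g x * v x ord0 i))); last first.
    apply: eq_Rintegral => x _; rewrite mulr_sumr.
    by apply: eq_bigr => i _; rewrite mulrCA.
  have igv i : intble (fun x => g x * v x ord0 i).
    by apply: L2_integrableM => //; exact: H10_L2 (Hv i).
  rewrite (Rintegral_fsum mO); last by move=> i; exact: integrable_EFinZ.
  apply: eq_bigr => i _; rewrite !RintegralZl//; congr (_ * _).
  rewrite -(weak_eq (Hv i)); apply: eq_Rintegral => x _.
  by apply: eq_bigr => j _; rewrite mxE.
have qE : I q = C * W.
  rewrite (Rintegral_fsum mO); last by move=> i; exact: integrable_EFinZ.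
  by rewrite /C mulr_suml; apply: eq_bigr => i _; rewrite RintegralZl.
have -> : l ^+ 2 * (C * W) = I (fun x => 2 * l * p x - l ^+ 2 * q x).
  rewrite RintegralB//; [|exact: integrable_EFinZ|exact: integrable_EFinZ].
  by rewrite !RintegralZl// pE qE; ring.
apply: le_Rintegral => //.
- by apply: integrable_EFinB => //; exact: integrable_EFinZ.
- exact: integrable_Dv2 Hv.
move=> x _; rewrite /p /q !mulr_sumr -sumrB; apply: ler_sum => i _.
rewrite !mulr_sumr -sumrB; apply: ler_sum => j _.
rewrite -subr_ge0; have := sqr_ge0 (Dv x i j - l * c i * Dw x ord0 j).
by congr (0 <= _); ring.
Qed.

End ridge_ratio.

Lemma ridge_delta i (x : 'rV[R]_n) : ridge (fun j => (j == i)%:R) x = x ord0 i.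
Proof.
rewrite /ridge (bigD1 i)//= eqxx mul1r big1 ?addr0// => j /negbTE ->.
by rewrite mul0r.
Qed.

Lemma sum_delta_sqr i : \sum_(j < n) ((j == i)%:R : R) ^+ 2 = 1.
Proof.
rewrite (bigD1 i)//= eqxx expr1n big1 ?addr0// => j /negbTE ->.
by rewrite expr0n.
Qed.

(** The identity [gridge] for merely square-integrable [g]: [v_i - l w] integrates
    to zero against continuous functions of [x_i], hence against [g]. *)
Lemma depends_only_on_ridge i g w Dw v Dv (l : R) :
  L2 Omega g -> depends_only_on Omega i g ->
  H10 Omega w Dw -> H10_vec Omega v Dv ->
  {ae mu, forall x, Omega x -> \tr (Dv x) = l * ridge (fun j => (j == i)%:R) (Dw x)} ->
  I (fun x => g x * ridge (fun j => (j == i)%:R) (v x)) =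
  l * (\sum_(j < n) (j == i)%:R ^+ 2) * I (fun x => g x * w x).
Proof.
move=> Lg gi Hw Hv trDv.
have [f mf gf] := depends_only_on_measurable oO (L2_measurable Lg) gi.
set c := fun j => (j == i)%:R : R.
pose F x := v x ord0 i - l * w x.
have Lv := H10_L2 (Hv i); have Lw := H10_L2 Hw.
have LF : L2 Omega F by apply: L2B => //; exact: L2Z.
have split (h : 'rV[R]_n -> R) : L2 Omega h ->
    I (fun x => h x * F x) = I (fun x => h x * v x ord0 i) - l * I (fun x => h x * w x).
  move=> Lh; rewrite -RintegralZl//; last exact: L2_integrableM.
  rewrite -RintegralB//; last 2 first.
  - exact: L2_integrableM.
  - by apply: integrable_EFinZ => //; exact: L2_integrableM.
  by apply: eq_Rintegral => x _; rewrite mulrBr [l * (_ * _)]mulrCA.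
have Fcont (h : R -> R) : continuous h -> I (fun x => h (x ord0 i) * F x) = 0.
  move=> ch; have Lh := continuous_ridge_L2 oO bO c ch.
  have := divergence_ridge oO bO ch Hv Hw trDv.
  rewrite sum_delta_sqr mulr1.
  under eq_Rintegral do rewrite !ridge_delta.
  under [in RHS]eq_Rintegral do rewrite !ridge_delta.
  move: Lh; under eq_fun do rewrite ridge_delta.
  by move=> Lh E; rewrite split// E subrr.
have Lf : L2 Omega (fun x => f (x ord0 i)).
  split; first exact: measurable_coord_comp.
  rewrite (eq_integral (fun x => (g x ^+ 2)%:E)); first by case: Lg.
  by move=> x; rewrite inE => Ox; rewrite gf.
have gF0 : I (fun x => g x * F x) = 0.
  rewrite -(null_measurable_fun oO bO LF Fcont mf Lf).
  by apply: eq_Rintegral => x; rewrite inE => Ox; rewrite gf.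
move: gF0; rewrite split// sum_delta_sqr mulr1 => /eqP; rewrite subr_eq0 => /eqP <-.
by apply: eq_Rintegral => x _; rewrite ridge_delta.
Qed.

End bogovskii_bounds.

(** * The dimension as a lower bound *)

Section lower_bound.
Variables (R : realType) (n : nat) (Omega : set 'rV[R]_n).
Hypotheses (oO : open Omega) (bO : bounded_set Omega) (neO : Omega !=set0).
Hypothesis n0 : (0 < n)%N.
Local Notation mu := (lebesgue_rV R n).
Local Notation I f := (Rintegral mu Omega f).
Local Notation intble f := (mu.-integrable Omega (EFin \o f)).
Let mO := open_measurable_rV oO.
Let finO := bounded_lebesgue_fin mO bO.
Let i0 : 'I_n := Ordinal n0.

Lemma coord_L2 i : L2 Omega (fun x : 'rV[R]_n => x ord0 i).
Proof.
have := @continuous_ridge_L2 R n Omega oO bO (fun j => (j == i)%:R) id (fun=> cvg_id).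
by under eq_fun do rewrite ridge_delta.
Qed.

Lemma test_fun_moment phi i j : test_fun Omega phi ->
  I (fun x => x ord0 i * partial j phi x) = - ((j == i)%:R * I phi).
Proof.
move=> tphi.
have d1 (t : R) : is_derive t 1 (id : R -> R) (cst 1 t) by exact: is_derive_id.
have := test_fun_ridge_ibp oO bO (fun j => (j == i)%:R) j
  (@cst_continuous _ _ (1 : R)) d1 tphi.
under eq_Rintegral do rewrite ridge_delta.
by under [in RHS]eq_Rintegral do rewrite mul1r.
Qed.

Lemma test_fun_partial_mean phi j : test_fun Omega phi -> I (partial j phi) = 0.
Proof.
move=> tphi.
have d1 (t : R) : is_derive t 1 (cst (1 : R)) (cst 0 t) by exact: is_derive_cst.
have := test_fun_ridge_ibp oO bO (fun=> 0) j (@cst_continuous _ _ (0 : R)) d1 tphi.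
rewrite mul0r oppr0 => <-.
by apply: eq_Rintegral => x _; rewrite mul1r.
Qed.

(** Testing the divergence against [x_i] reads off the integral of [v_i]. *)
Lemma H10_vec_moment v Dv i : H10_vec Omega v Dv ->
  I (fun x => x ord0 i * \tr (Dv x)) = - I (fun x => v x ord0 i).
Proof.
move=> Hv; have LDv k j : L2 Omega (fun x => Dv x k j) := H10_vec_L2 k j Hv.
have d1 (t : R) : is_derive t 1 (id : R -> R) (cst 1 t) by exact: is_derive_id.
under eq_Rintegral do rewrite mulr_sumr.
rewrite (Rintegral_fsum mO); last first.
  by move=> j; apply: L2_integrableM => //; exact: coord_L2.
have E j : I (fun x => x ord0 i * Dv x j j) = - ((j == i)%:R * I (fun x => v x ord0 j)).
  have := H10_ridge_ibp oO bO (fun j => (j == i)%:R) j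
    (@cst_continuous _ _ (1 : R)) d1 (Hv j).
  under eq_Rintegral do rewrite ridge_delta mxE.
  by under [in RHS]eq_Rintegral do rewrite mul1r.
rewrite (eq_bigr _ (fun j _ => E j)) sumrN (bigD1 i)//= eqxx mul1r big1 ?addr0//.
by move=> j /negbTE ->; rewrite mul0r.
Qed.

(** [int phi = - int x_i d_i phi], so the mass of [phi] is controlled by a single
    partial derivative. This bounds the quotient [(int phi)^2 / |grad phi|^2] and
    shows that [d_i phi] does not vanish when [int phi] does not. *)
Lemma test_fun_mean_bound phi i : test_fun Omega phi ->
  I phi ^+ 2 <= I (fun x => x ord0 i ^+ 2) * I (fun x => partial i phi x ^+ 2).
Proof.
move=> tphi; have := test_fun_moment i i tphi; rewrite eqxx mul1r.
move=> /(congr1 (fun t => t ^+ 2)); rewrite sqrrN => <-.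
by apply: cauchy_schwarz => //; [exact: coord_L2|exact: test_fun_partial_L2].
Qed.

Let energy (phi : 'rV[R]_n -> R) := I (fun x => \sum_(i < n) partial i phi x ^+ 2).

Lemma energyE phi : test_fun Omega phi ->
  energy phi = \sum_(i < n) I (fun x => partial i phi x ^+ 2).
Proof.
move=> tphi; rewrite /energy (Rintegral_fsum mO)// => i.
by apply: L2_integrable_sqr; exact: test_fun_partial_L2.
Qed.

Lemma partial_le_energy phi i : test_fun Omega phi ->
  I (fun x => partial i phi x ^+ 2) <= energy phi.
Proof.
move=> tphi; rewrite energyE// (bigD1 i)//= lerDl sumr_ge0// => j _.
exact: Rintegral_sqr_ge0.
Qed.

Lemma H10_mean_bound (S : R) w Dw :
  (forall phi, test_fun Omega phi -> I phi ^+ 2 <= S * energy phi) ->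
  H10 Omega w Dw -> I w ^+ 2 <= S * I (fun x => \sum_(i < n) Dw x ord0 i ^+ 2).
Proof.
move=> SP Hw; have [phi [tphi cvphi cvD]] := H10_approx oO bO Hw.
have Lphi k := test_fun_L2 oO bO (tphi k).
have Lphii k i := test_fun_partial_L2 oO bO i (tphi k).
have c1 : I (phi k) @[k --> \oo] --> I w.
  have := L2_cvg_inner mO Lphi (H10_L2 Hw) (L2_cst mO 1 finO) cvphi.
  under eq_fun do under eq_Rintegral do rewrite mulr1.
  by under [X in _ --> X]eq_Rintegral do rewrite mulr1.
have c2 : energy (phi k) @[k --> \oo] --> I (fun x => \sum_(i < n) Dw x ord0 i ^+ 2).
  under eq_fun do rewrite energyE//.
  rewrite (Rintegral_fsum mO); last first.
    by move=> i; apply: L2_integrable_sqr; exact: H10_L2_grad Hw.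
  apply: cvg_big => [|i _]; first exact: add_continuous.
  exact: (L2_cvg_sqr mO (fun k => Lphii k i) (H10_L2_grad i Hw) (cvD i)).
have c3 : I (phi k) ^+ 2 @[k --> \oo] --> I w ^+ 2.
  by rewrite expr2; under eq_fun do rewrite expr2; exact: cvgM.
have c4 : S * energy (phi k) @[k --> \oo] -->
    S * I (fun x => \sum_(i < n) Dw x ord0 i ^+ 2).
  by apply: cvgM => //; exact: cvg_cst.
apply: (ler_cvg_to c3 c4); apply: nearW => k; exact: SP.
Qed.

Lemma ball_measure_gt0 (x : 'rV[R]_n) (e : R) : 0 < e -> (0 < mu (ball x e))%E.
Proof.
move=> e0; rewrite rV_ballE// (_ : mkset _ =
   [set y | forall i, `](x ord0 i - e)%R, (x ord0 i + e)%R[%classic (y ord0 i)]); last first.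
  apply/seteqP; split => y yx i; have := yx i; rewrite /= in_itv/=.
    by rewrite ltr_distlC.
  by rewrite ltr_distlC.
rewrite (@lebesgue_rVE R n (fun i => `](x ord0 i - e)%R, (x ord0 i + e)%R[%classic))//.
elim/big_ind : _ => //; first by move=> a b a0 b0; exact: mule_gt0.
move=> i _; rewrite lebesgue_measure_itv/= lte_fin.
have -> : (x ord0 i - e < x ord0 i + e) by rewrite ltrD2l gt0_cp.
by rewrite -EFinB lte_fin; lra.
Qed.

Lemma Rintegral_continuous_gt0 (p : 'rV[R]_n -> R) x0 : continuous p ->
  (forall x, 0 <= p x) -> Omega x0 -> 0 < p x0 -> intble p -> 0 < I p.
Proof.
move=> cp p0 Ox0 px0 ip.
have [e e0 be] : exists2 e : R, 0 < e &
    ball x0 e `<=` Omega `&` [set x | p x0 / 2 < p x].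
  have : nbhs x0 (Omega `&` [set x | p x0 / 2 < p x]).
    apply: filterI; first exact: open_nbhs_nbhs.
    apply: (cp x0 [set t | p x0 / 2 < t]).
    apply: open_nbhs_nbhs; split; first exact: open_gt.
    by rewrite /= ltr_pdivrMr//; lra.
  by move=> /nbhs_ballP[e /= e0 be]; exists e.
have mB := measurable_rV_ball x0 e0.
have BO : ball x0 e `<=` Omega by move=> x /be[].
have Bfin : (mu (ball x0 e) < +oo)%E.
  by apply: le_lt_trans finO; apply: le_measure; rewrite ?inE.
rewrite -lte_fin -(integral_RintegralE oO ip).
apply: (@lt_le_trans _ _ (\int[mu]_(x in ball x0 e) (cst (p x0 / 2)%:E x))%E).
  rewrite integral_cst// mule_gt0 ?ball_measure_gt0// lte_fin.
  by rewrite divr_gt0.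
apply: (@le_trans _ _ (\int[mu]_(x in ball x0 e) (p x)%:E)%E).
  apply: ge0_le_integral => //.
  - by move=> x _; rewrite lee_fin divr_ge0// ltW.
  - apply/measurable_EFinP; apply: measurable_funTS; exact: continuous_measurable_rV.
  - by move=> x /be[_ /= /ltW].
apply: ge0_subset_integral => //.
- by apply/measurable_EFinP; apply: measurable_funTS; exact: continuous_measurable_rV.
- by move=> x _; rewrite lee_fin.
Qed.

(** A coordinate is not constant on a nonempty open set: a point where it differs
    from [m] is found by a diagonal shift inside a ball. *)
Lemma coord_variance_gt0 (m : R) : 0 < I (fun x => (x ord0 i0 - m) ^+ 2).
Proof.
have Lp : L2 Omega (fun x : 'rV[R]_n => x ord0 i0 - m).
  by apply: L2B => //; [exact: coord_L2|exact: L2_cst].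
have [x1 Ox1 x1m] : exists2 x, Omega x & x ord0 i0 != m.
  have [x Ox] := neO; have [xm|] := eqVneq (x ord0 i0) m; last by exists x.
  have /nbhs_ballP[e /= e0 be] : nbhs x Omega by exact: open_nbhs_nbhs.
  exists (x + (e / 2) *: const_mx 1).
    apply: be; rewrite rV_ballE// => i; rewrite !mxE mulr1 opprD addrA subrr sub0r normrN.
    by rewrite gtr0_norm; lra.
  by rewrite !mxE xm mulr1 gt_eqF// ltrDl divr_gt0.
apply: (@Rintegral_continuous_gt0 _ x1) => //.
- have cd : continuous (fun x : 'rV[R]_n => x ord0 i0 - m).
    apply: rV_continuousD; first exact: coord_continuous.
    exact: rV_continuous_cst.
  under eq_fun do rewrite expr2; exact: rV_continuousM.
- by move=> x; exact: sqr_ge0.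
- by rewrite exprn_even_gt0//= subr_eq0.
- exact: L2_integrable_sqr.
Qed.

(** All components of admissible fields have integral zero, so the divergence is
    orthogonal to [x_i]; no positive multiple of [x_i - mean] is then the
    divergence of such a field. *)
Lemma bogovskii_ge_no_mass : (forall phi, test_fun Omega phi -> I phi = 0) ->
  (n%:R%:E <= bogovskii Omega)%E.
Proof.
move=> I0.
pose V := fine (mu Omega).
have V0 : 0 < V.
  rewrite fine_gt0// finO andbT.
  have [x Ox] := neO.
  have /nbhs_ballP[e /= e0 be] : nbhs x Omega by exact: open_nbhs_nbhs.
  apply: lt_le_trans (ball_measure_gt0 x e0) _.
  by apply: le_measure; rewrite ?inE//; exact: measurable_rV_ball.
pose m := I (fun x => x ord0 i0) / V.
have Lx := coord_L2 i0.
have Ld : L2 Omega (fun x : 'rV[R]_n => x ord0 i0 - m).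
  by apply: L2B => //; exact: L2_cst.
have Id0 : I (fun x => x ord0 i0 - m) = 0.
  rewrite RintegralB//; last 2 first.
  - exact: L2_integrable.
  - exact: (L2_integrable mO finO (L2_cst mO m finO)).
  by rewrite Rintegral_cst// /m -/V divfK ?subrr// gt_eqF.
have N0 := coord_variance_gt0 m.
apply: (bogovskii_normalized_ge oO bO Ld Id0 N0) => v Dv l Hv l0 lN trDv.
(* The bound [(int phi)^2 <= 0] passes from test functions to their limits. *)
have Iv : I (fun x => v x ord0 i0) = 0.
  have H0 phi : test_fun Omega phi -> I phi ^+ 2 <= 0 * energy phi.
    by move=> /I0 ->; rewrite expr0n mul0r.
  have := H10_mean_bound H0 (Hv i0); rewrite mul0r => h; apply/eqP.
  by rewrite -sqrf_eq0 eq_le h sqr_ge0.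
have := H10_vec_moment i0 Hv; rewrite Iv oppr0.
have LDv k j : L2 Omega (fun x => Dv x k j) := H10_vec_L2 k j Hv.
have Ltr : L2 Omega (fun x => \tr (Dv x)) by apply: L2_sum.
have Lld : L2 Omega (fun x : 'rV[R]_n => l * (x ord0 i0 - m)) by exact: L2Z.
rewrite (@Rintegral_ae_eq _ _ _ oO _
  (fun x => x ord0 i0 * (l * (x ord0 i0 - m)))); last 3 first.
- by apply: measurable_funM; exact: L2_measurable.
- by apply: measurable_funM; exact: L2_measurable.
- by apply: filterS trDv => x E Ox; rewrite E.
rewrite (_ : I _ = l * I (fun x => (x ord0 i0 - m) ^+ 2)).
  by move/eqP; rewrite mulf_eq0 !gt_eqF.
have i1 := L2_integrable_sqr Ld; have i2 := L2_integrable mO finO Ld.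
transitivity (I (fun x => l * (x ord0 i0 - m) ^+ 2 + l * m * (x ord0 i0 - m))).
  by apply: eq_Rintegral => x _; ring.
rewrite RintegralD//; [|exact: integrable_EFinZ|exact: integrable_EFinZ].
by rewrite !RintegralZl// Id0 mulr0 addr0.
Qed.

(** A test function [phi] within a factor [r < 1] of the supremum [S] of
    [(int phi)^2 / |grad phi|^2] yields the bound [r n]; then [r] tends to [1]. *)
Lemma bogovskii_ge_mass phi0 : test_fun Omega phi0 -> I phi0 != 0 ->
  (n%:R%:E <= bogovskii Omega)%E.
Proof.
move=> tphi0 phi0n0.
have egt0 phi i : test_fun Omega phi -> I phi != 0 ->
    0 < I (fun x => partial i phi x ^+ 2).
  move=> tphi phin0; rewrite lt0r Rintegral_sqr_ge0 andbT; apply/eqP => E0.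
  have := test_fun_mean_bound i tphi; rewrite E0 mulr0.
  by rewrite leNgt lt0r sqr_ge0 sqrf_eq0 phin0.
have energy_gt0 phi : test_fun Omega phi -> I phi != 0 -> 0 < energy phi.
  move=> tphi phin0.
  exact: lt_le_trans (egt0 _ i0 tphi phin0) (partial_le_energy _ tphi).
pose A := [set r : R | exists phi,
  [/\ test_fun Omega phi, I phi != 0 & r = I phi ^+ 2 / energy phi]].
have supA : has_sup A.
  split; first by exists (I phi0 ^+ 2 / energy phi0); exists phi0.
  exists (I (fun x => x ord0 i0 ^+ 2)) => _ [phi [tphi phin0 ->]].
  rewrite ler_pdivrMr ?energy_gt0// (le_trans (test_fun_mean_bound i0 tphi))//.
  by rewrite ler_wpM2l ?Rintegral_sqr_ge0//; exact: partial_le_energy.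
pose S := sup A.
have SP phi : test_fun Omega phi -> I phi ^+ 2 <= S * energy phi.
  move=> tphi; have [->|phin0] := eqVneq (I phi) 0.
    rewrite expr0n/= mulr_ge0//.
      apply: le_trans (_ : I phi0 ^+ 2 / energy phi0 <= _).
        by rewrite divr_ge0 ?sqr_ge0// ltW// energy_gt0.
      by apply: (sup_upper_bound supA); exists phi0.
    by rewrite energyE// sumr_ge0// => i _; exact: Rintegral_sqr_ge0.
  rewrite -ler_pdivrMr ?energy_gt0//.
  by apply: (sup_upper_bound supA); exists phi.
have S0 : 0 < S.
  apply: lt_le_trans (_ : I phi0 ^+ 2 / energy phi0 <= _).
    by rewrite divr_gt0 ?energy_gt0// exprn_even_gt0.
  by apply: (sup_upper_bound supA); exists phi0.
apply/lee_mul01Pr; first by rewrite lee_fin.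
move=> r /andP[r0 r1].
have [_ [phi [tphi phin0 ->]] Sphi] : exists2 a, A a & r * S < a.
  apply: sup_gt => //; first by case: supA.
  by rewrite gtr_pMl.
have e0 := energy_gt0 _ tphi phin0.
rewrite ltr_pdivlMr// in Sphi.
(* Averaging: some partial derivative carries at most a share [1/n] of the
   energy. *)
have [i ie] : exists i, n%:R * I (fun x => partial i phi x ^+ 2) <= energy phi.
  apply/not_existsP => H.
  have : \sum_(i < n) energy phi < \sum_(i < n) n%:R * I (fun x => partial i phi x ^+ 2).
    apply: ltr_sum; first by apply/hasP; exists i0; rewrite ?mem_index_enum.
    by move=> i _; rewrite ltNge; exact/negP.
  by rewrite -mulr_sumr -energyE// sumr_const card_ord mulr_natl ltxx.
have Lphi := test_fun_partial_L2 oO bO i tphi.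
apply: (bogovskii_normalized_ge oO bO Lphi (test_fun_partial_mean i tphi)
  (egt0 _ i tphi phin0)).
move=> v Dv l Hv l0 lN trDv.
have LDv k j : L2 Omega (fun x => Dv x k j) := H10_vec_L2 k j Hv.
have Iv : I (fun x => v x ord0 i) = l * I phi.
  have Ltr : L2 Omega (fun x => \tr (Dv x)) by apply: L2_sum.
  have Lx := coord_L2 i.
  have Lld : L2 Omega (fun x : 'rV[R]_n => l * partial i phi x) by exact: L2Z.
  apply/eqP; rewrite -eqr_opp -(H10_vec_moment i Hv); apply/eqP.
  rewrite (@Rintegral_ae_eq _ _ _ oO _
    (fun x => x ord0 i * (l * partial i phi x))); last 3 first.
  - by apply: measurable_funM; exact: L2_measurable.
  - by apply: measurable_funM; exact: L2_measurable.
  - by apply: filterS trDv => x E Ox; rewrite E.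
  transitivity (I (fun x => l * (x ord0 i * partial i phi x))).
    by apply: eq_Rintegral => x _; rewrite mulrCA.
  rewrite RintegralZl//; last exact: L2_integrableM.
  by rewrite test_fun_moment// eqxx mul1r mulrN.
have vi := H10_mean_bound SP (Hv i); rewrite Iv in vi.
set Ev := (X in _ <= S * X) in vi.
have EvD : Ev <= I (fun x => \sum_(k < n) \sum_(j < n) Dv x k j ^+ 2).
  have iv : intble (fun x => \sum_(j < n) row i (Dv x) ord0 j ^+ 2).
    apply: integrable_fsum => // j; apply: L2_integrable_sqr.
    exact: H10_L2_grad (Hv i).
  apply: (le_Rintegral mO iv (integrable_Dv2 oO Hv)).
  move=> x _; rewrite [leRHS](bigD1 i)//= -[leLHS]addr0 lerD//.
    by apply: ler_sum => j _; rewrite mxE.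
  by apply: sumr_ge0 => k _; apply: sumr_ge0 => j _; exact: sqr_ge0.
apply: le_trans EvD.
rewrite -(ler_pM2l S0); apply: le_trans vi.
set e := I (fun x => partial i phi x ^+ 2) in ie lN *.
have -> : S * (r * n%:R) = l ^+ 2 * (r * S * (n%:R * e)).
  by rewrite -[LHS]mulr1 -[X in _ * X = _]lN; ring.
rewrite exprMn.
rewrite ler_wpM2l ?sqr_ge0//; apply: le_trans (ltW Sphi).
by apply: ler_wpM2l => //; exact: ltW (mulr_gt0 r0 S0).
Qed.

Theorem bogovskii_ge_dim : (n%:R%:E <= bogovskii Omega)%E.
Proof.
have [I0|] := pselect (forall phi, test_fun Omega phi -> I phi = 0).
  exact: bogovskii_ge_no_mass.
move=> /existsNP[phi /not_implyP[tphi /eqP phin0]].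
exact: bogovskii_ge_mass tphi phin0.
Qed.

End lower_bound.

(** * The two sufficient conditions for strict inequality *)

Lemma sqr_sum (R : realType) (n : nat) (a : 'I_n -> R) :
  (\sum_(i < n) a i) ^+ 2 =
  \sum_(i < n) a i ^+ 2 + 2 * \sum_(i < n) \sum_(j < n | (i < j)%N) a i * a j.
Proof.
have -> : (\sum_(i < n) a i) ^+ 2 = \sum_(i < n) (a i ^+ 2 +
    (\sum_(j < n | (i < j)%N) a i * a j + \sum_(j < n | (j < i)%N) a i * a j)).
  rewrite expr2 mulr_suml; apply: eq_bigr => i _.
  rewrite mulr_sumr (bigD1 i)//= expr2; congr (_ + _).
  rewrite (bigID (fun j : 'I_n => (i < j)%N))/=; congr (_ + _).
    by apply: eq_bigl => j; rewrite -val_eqE/= neq_ltn; case: ltngtP.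
  by apply: eq_bigl => j; rewrite -val_eqE/= neq_ltn; case: ltngtP.
rewrite !big_split/=; congr (_ + _); rewrite mulr_natl mulr2n; congr (_ + _).
rewrite (exchange_big_dep xpredT)//=.
by apply: eq_bigr => i _; apply: eq_bigr => j _; rewrite mulrC.
Qed.

Theorem theorem2p5 (R : realType) (n : nat) (Omega : set 'rV[R]_n) :
  (2 <= n)%N -> bounded_lipschitz_domain Omega ->
  (n%:R%:E <= bogovskii Omega)%E /\
  ((exists (i : 'I_n) (g w : 'rV[R]_n -> R) (Dw : 'rV[R]_n -> 'rV[R]_n),
      [/\ depends_only_on Omega i g, L2 Omega g, weak_solution Omega g w Dw &
        (\int[lebesgue_rV R n]_(x in Omega) (Dw x ord0 i ^+ 2)%:E <
         (n%:R^-1)%:E *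
           \int[lebesgue_rV R n]_(x in Omega) (\sum_(j < n) Dw x ord0 j ^+ 2)%:E)%E]) \/
   (exists (h : R -> R) (w : 'rV[R]_n -> R) (Dw : 'rV[R]_n -> 'rV[R]_n),
      [/\ continuous h,
        weak_solution Omega (fun x => h (\sum_(i < n) x ord0 i)) w Dw &
        (\sum_(i < n) \sum_(j < n | (i < j)%N)
           \int[lebesgue_rV R n]_(x in Omega) (Dw x ord0 i * Dw x ord0 j)%:E < 0)%E]) ->
   (n%:R%:E < bogovskii Omega)%E).
Proof.
move=> n2 [oO _ neO bO _].
have n0 : (0 < n)%N by apply: leq_trans n2.
have nR0 : (0 : R) < n%:R by rewrite ltr0n.
split; first exact: bogovskii_ge_dim.
have mO := open_measurable_rV oO.
case=> [[i [g [w [Dw [gi Lg wsol]]]]]|[h [w [Dw [ch wsol]]]]].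
- have Hw : H10 Omega w Dw by case: wsol.
  have LDw j := H10_L2_grad j Hw.
  rewrite !(integral_RintegralE oO); last 2 first.
  - by apply: integrable_fsum => // j; exact: L2_integrable_sqr.
  - exact: L2_integrable_sqr.
  rewrite -EFinM lte_fin -/(grad_energy Omega Dw) => lt.
  have W0 : 0 < grad_energy Omega Dw.
    have := le_lt_trans (Rintegral_sqr_ge0 Omega (fun x => Dw x ord0 i)) lt.
    by rewrite pmulr_rgt0 ?invr_gt0.
  have K v Dv l (Hv : H10_vec Omega v Dv) trDv :=
    @depends_only_on_ridge R n Omega oO bO i g w Dw v Dv l Lg gi Hw Hv trDv.
  have c0 : 0 < \sum_(j < n) ((j == i)%:R : R) ^+ 2 by rewrite sum_delta_sqr.
  have Ngt0 := ridge_energy_gt0 oO wsol K c0 W0.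
  have := bogovskii_ge_ridge_ratio oO bO Lg wsol K c0 W0.
  apply: lt_le_trans; rewrite lte_fin sum_delta_sqr mul1r ltr_pdivlMr//.
  rewrite -ltr_pdivlMl//; apply: le_lt_trans lt.
  by under eq_Rintegral do rewrite ridge_delta.
- have Hw : H10 Omega w Dw by case: wsol.
  have LDw j := H10_L2_grad j Hw.
  have iD k j := L2_integrableM mO (LDw k) (LDw j).
  under eq_bigr do under eq_bigr do rewrite (integral_RintegralE oO)//.
  under eq_bigr do rewrite sumEFin.
  rewrite sumEFin lte_fin; set Sx := (X in X < 0) => S0.
  pose c (j : 'I_n) : R := 1.
  have ridge1 x : ridge c x = \sum_(j < n) x ord0 j.
    by apply: eq_bigr => j _; rewrite mul1r.
  have c2 : \sum_(j < n) c j ^+ 2 = n%:R.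
    under eq_bigr do rewrite expr1n.
    by rewrite sumr_const card_ord.
  have NE : Rintegral (lebesgue_rV R n) Omega (fun x => ridge c (Dw x) ^+ 2) =
      grad_energy Omega Dw + 2 * Sx.
    transitivity (Rintegral (lebesgue_rV R n) Omega (fun x =>
        \sum_(i < n) Dw x ord0 i ^+ 2 +
        2 * \sum_(i < n) \sum_(j < n | (i < j)%N) Dw x ord0 i * Dw x ord0 j)).
      by apply: eq_Rintegral => x _; rewrite ridge1 sqr_sum.
    have i2 : (lebesgue_rV R n).-integrable Omega (EFin \o (fun x =>
        \sum_(i < n) \sum_(j < n | (i < j)%N) Dw x ord0 i * Dw x ord0 j)).
      by apply: integrable_fsum => // i; exact: integrable_fsum.
    rewrite RintegralD//; last 2 first.
    - by apply: integrable_fsum => // j; exact: L2_integrable_sqr.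
    - exact: integrable_EFinZ.
    congr (_ + _); rewrite RintegralZl// (Rintegral_fsum mO); last first.
      by move=> i; exact: integrable_fsum.
    by congr (_ * _); apply: eq_bigr => i _; rewrite (Rintegral_fsum mO).
  have W0 : 0 < grad_energy Omega Dw.
    have := Rintegral_sqr_ge0 Omega (fun x => ridge c (Dw x)); rewrite NE.
    by move=> ?; lra.
  have hE : (fun x : 'rV[R]_n => h (\sum_(i < n) x ord0 i)) = (fun x => h (ridge c x)).
    by apply/funext => x; rewrite ridge1.
  rewrite hE in wsol.
  have Lg := continuous_ridge_L2 oO bO c ch.
  have K v Dv l (Hv : H10_vec Omega v Dv)
      (trDv : {ae lebesgue_rV R n, forall x, Omega x ->
                \tr (Dv x) = l * ridge c (Dw x)}) :=
    divergence_ridge oO bO ch Hv Hw trDv.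
  have c0 : 0 < \sum_(j < n) c j ^+ 2 by rewrite c2.
  have Ngt0 := ridge_energy_gt0 oO wsol K c0 W0.
  have := bogovskii_ge_ridge_ratio oO bO Lg wsol K c0 W0.
  apply: lt_le_trans; rewrite lte_fin c2 ltr_pdivlMr// ltr_pM2l// NE.
  by lra.
Qed.
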